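(* Let $T>0$, $c_1>c_2>0$ and $0<a_1<a_2$. Put $t^*:=\frac{a_2-a_1}{c_1-c_2}$ and $t_2:=\frac{a_2}{c_2}$. For $N\in\mathbb{N}$ let $$\psi_T(N):=\mathbb{P}\left(\sup_{t\in[0,T]}\left(\sum_{k=1}^{N}B_k(t)-c_1Nt\right)>a_1N,\ \sup_{t\in[0,T]}\left(\sum_{k=1}^{N}B_k(t)-c_2Nt\right)>a_2N\right),$$ where $\{B_k(t):t\ge0\}$, $k=1,\dots,N$, are mutually independent standard Brownian motions. Suppose that $t^*\ge T$. (i) If $t_2>T$, then, as $N\to\infty$, $$\psi_T(N)=\frac{1}{\sqrt{2\pi}}\left(\frac{\sqrt{T}}{a_2+c_2T}+\frac{\sqrt{T}}{a_2-c_2T}\right)\frac{1}{\sqrt{N}}\,e^{-\frac{(a_2+c_2T)^2}{2T}N}(1+o(1)).$$ (ii) If $t_2=T$, then, as $N\to\infty$, $$\psi_T(N)=\frac12\,e^{-2a_2c_2N}(1+o(1)).$$ (iii) If $t_2<T$, then, as $N\to\infty$, $$\psi_T(N)=e^{-2a_2c_2N}(1+o(1)).$$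
   Context: $f(N)=g(N)(1+o(1))$ as $N\to\infty$ means $\lim_{N\to\infty}f(N)/g(N)=1$. Standard Brownian motions start at $0$. The number $t^*$ is the unique point of intersection of the lines $t\mapsto a_1+c_1t$ and $t\mapsto a_2+c_2t$. *)

(* Defs.v *)
From HB Require Import structures.
From mathcomp Require Import all_boot all_order all_algebra.
From mathcomp Require Import all_classical all_reals all_analysis.

Set Implicit Arguments.
Unset Strict Implicit.
Unset Printing Implicit Defensive.

Import Order.TTheory GRing.Theory Num.Theory.
Import numFieldNormedType.Exports.

Local Open Scope classical_set_scope.
Local Open Scope ring_scope.

(* To be used for sigma-algebras [F i]: since they contain [setT], the product
   rule over all of [I] entails the one over every subfamily. *)
Definition mutually_independent (R : realType) (d : measure_display)
    (Omega : measurableType d) (P : probability Omega R) (I : finType)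
    (F : I -> set (set Omega)) : Prop :=
  forall A : I -> set Omega, (forall i, F i (A i)) ->
    P (\bigcap_(i in [set: I]) A i) = (\prod_(i : I) P (A i))%E.

(* Processes are indexed by all of [R], but only the times [t >= 0] are ever
   constrained or used. *)
Definition process_sigma_algebra (R : realType) (d : measure_display)
    (Omega : measurableType d) (P : probability Omega R)
    (X : R -> {RV P >-> R}) : set (set Omega) :=
  <<s \bigcup_(t in `[0, +oo[) g_sigma_algebra_preimage (X t) >>.

(* The second parameter of [normal_prob] is the standard deviation. *)
Record standard_brownian_motion (R : realType) (d : measure_display)
    (Omega : measurableType d) (P : probability Omega R)
    (B : R -> {RV P >-> R}) : Prop := StandardBrownianMotion {
  sbm_start : {ae P, forall w, B 0 w = 0};
  sbm_independent_increments : forall (n : nat) (t : nat -> R),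
    0 <= t 0%N -> nondecreasing_seq t ->
    mutually_independent P
      (fun i : 'I_n => g_sigma_algebra_preimage (B (t i.+1) \- B (t i)));
  sbm_gaussian_increments : forall s t : R, 0 <= s -> s < t ->
    forall A : set R, measurable A ->
      P ((B t \- B s) @^-1` A) = normal_prob 0 (Num.sqrt (t - s)) A;
  sbm_continuous : forall w : Omega,
    {within `[0, +oo[, continuous (fun t : R => B t w)}
}.

Definition independent_standard_brownian_motions (R : realType)
    (d : measure_display) (Omega : measurableType d) (P : probability Omega R)
    (N : nat) (B : 'I_N -> R -> {RV P >-> R}) : Prop :=
  (forall k, standard_brownian_motion (B k)) /\
  mutually_independent P (fun k => process_sigma_algebra (B k)).

Definition exceedance (R : realType) (d : measure_display)
    (Omega : measurableType d) (P : probability Omega R)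
    (N : nat) (B : 'I_N -> R -> {RV P >-> R}) (T a c : R) : set Omega :=
  [set w | ((a * N%:R)%:E <
    ereal_sup [set ((\sum_(k < N) B k t w) - c * N%:R * t)%R%:E
      | t in [set` `[0%R, T]]])%E].

Definition psi (R : realType) (d : measure_display)
    (Omega : measurableType d) (P : probability Omega R)
    (N : nat) (B : 'I_N -> R -> {RV P >-> R}) (T a1 c1 a2 c2 : R) : R :=
  fine (P (exceedance B T a1 c1 `&` exceedance B T a2 c2)).

Definition asymp_equal (R : realType) (f g : nat -> R) : Prop :=
  (fun N => f N / g N) @ \oo --> (1 : R).

(* Main.v *)
Require Import Defs.
From HB Require Import structures.
From mathcomp Require Import all_boot all_order all_algebra.
From mathcomp Require Import all_classical all_reals all_analysis.
From mathcomp Require Import lebesgue_measure measurable_realfun.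
From mathcomp Require Import ring lra.

(** Both events are expressed through W = B_1 + ... + B_N, a Brownian motion
    with variance N t at time t. For t <= T <= t^* the line a_2 + c_2 t lies
    above a_1 + c_1 t, so crossing the second line entails crossing the first
    and psi_T(N) is the probability that W crosses a_2 N + c_2 N t before T.
    That probability has a closed form ([passage_probability]): if W has
    variance nu t, then for x > 0 and mu >= 0
      P(W_t > mu t + x for some t <= T)
        = Q(mu T + x) + exp(- 2 mu x / nu) Q(x - mu T),
    where Q(b) = P(N(0, nu T) > b). Each part of the theorem is then an
    asymptotic evaluation of the two Gaussian tails.

    The closed form is a reflection principle with drift. Let
    Y_t = W_t - mu t - x be the signed distance to the line, let
    th = 2 mu / nu, and pay h(Y_T) at time T, where h(y) = 1 + exp(th y) for
    y > 0 and h(y) = 0 for y <= 0 ([barrier_payoff]). The exponential tilts the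
    Gaussian law by exactly the amount that reverses the drift, so that the
    mean payoff of a path standing on the line is Q(k) + Q(-k) = 1, whatever
    time is left; as h is nondecreasing, that mean is at least 1 above the line
    and at most 1 below it ([payoff_mean_ge1], [payoff_mean_le1]). A path
    receives a payoff only if it has crossed, and at its crossing the mean
    payoff still to come is 1: hence E h(Y_T) is the crossing probability, and
    E h(Y_T) is the right-hand side above ([integral_barrier_payoff]).

    This argument is run on finite grids of times, where only the independence
    of the past and the increments is needed. On a grid the walk jumps over the
    line and lands strictly above it, which gives
      P(crossing on the grid) <= E h(Y_T)  ([passage_le_integral]).
    For the converse inequality the payoff is shifted to h(y - e): a walk
    landing at height at most e expects at most 1, and so
      E h(Y_T - e) <= P(crossing on the grid) + E[h(Y_T - e); overshoot > e]
    ([integral_le_passage]). Uniform continuity of the paths makes the last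
    term vanish as the grid is refined, and e is sent to 0 at the end.

    That the sum W has the required law and independence comes from splitting
    the array of increments of all the B_k into two blocks
    ([mutually_independent_blocks]) and from the convolution of two Gaussian
    densities ([normal_rvD]). The asymptotics rest on the two-sided Mills bound
    for Gaussian tails ([normal_tail_mills]). *)

Import Order.TTheory GRing.Theory Num.Theory.
Import numFieldNormedType.Exports.

Set Implicit Arguments.
Unset Strict Implicit.
Unset Printing Implicit Defensive.

Local Open Scope classical_set_scope.
Local Open Scope ring_scope.

(** * Independence of blocks and freezing *)

(** Pi-lambda argument: the events independent of a fixed [B] form a
    lambda-system. *)
Lemma independent_of_generated (R : realType) (d : measure_display)
    (Omega : measurableType d) (P : probability Omega R)
    (G : set (set Omega)) (B : set Omega) :
  setI_closed G -> G `<=` measurable -> measurable B ->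
  (forall A, G A -> P (A `&` B) = P A * P B)%E ->
  forall A, <<s G >> A -> (P (A `&` B) = P A * P B)%E.
Proof.
move=> GI Gm mB GB A sA.
have sm : <<s G >> `<=` measurable by apply: smallest_sub => //;
  exact: sigma_algebra_measurable.
suff: <<s G >> `<=` [set A | measurable A /\ (P (A `&` B) = P A * P B)%E].
  by move=> /(_ _ sA)[].
apply: lambda_system_subset; [by []| | |by []]; last first.
  by move=> C GC; split; [exact: Gm|exact: GB].
apply/dynkin_lambda_system; split.
- by split => //; rewrite setTI probability_setT mul1e.
- move=> C [mC CB]; split; first exact: measurableC.
  rewrite setIC -setDE measureD//; last by rewrite ltey_eq fin_num_measure.
  rewrite (setIC B C) [X in (_ - X)%E]CB probability_setC// muleBl
    ?fin_num_measure// ?mul1e//.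
- move=> F tF FB; split; first by apply: bigcup_measurable => k _;
    exact: (FB k).1.
  rewrite setI_bigcupl !measure_bigcup//; last 3 first.
    by move=> i _; exact: (FB i).1.
    by move=> i _; apply: measurableI => //; exact: (FB i).1.
    apply/trivIsetP => i j _ _ ij; rewrite setIACA.
    by move/trivIsetP : tF => /(_ i j Logic.I Logic.I ij) ->; rewrite set0I.
  transitivity (\sum_(i <oo | i \in [set: nat]) ((fine (P B))%:E * P (F i)))%E.
    by apply: eq_eseriesr => i _;
      rewrite fineK ?fin_num_measure// [LHS](FB i).2 muleC.
  by rewrite nneseriesZl// fineK ?fin_num_measure// muleC.
Qed.

Lemma bigcap_finType (T : Type) (I : finType) (A : I -> set T) :
  \bigcap_(i in [set: I]) A i = \big[setI/setT]_(i : I) A i.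
Proof.
rewrite -bigcap_seq; apply: eq_bigcapl; split=> i //= _.
by rewrite mem_index_enum.
Qed.

(** Intersections of one event of each [F i], with only the indices of [J]
    constrained: the pi-system that generates the sigma-algebra of the block
    [J]. *)
Definition cylinders (T : Type) (I : Type) (J : pred I)
    (F : I -> set (set T)) : set (set T) :=
  [set C | exists2 A : I -> set T,
     (forall i, F i (A i) /\ (~~ J i -> A i = setT)) &
     C = \bigcap_(i in [set: I]) A i].

Lemma cylinders_setI (T I : Type) (J : pred I) (F : I -> set (set T)) :
  (forall i, setI_closed (F i)) -> setI_closed (cylinders J F).
Proof.
move=> FI _ _ [A AF ->] [B BF ->]; exists (fun i => A i `&` B i).
  move=> i; split; first by apply: FI; [exact: (AF i).1|exact: (BF i).1].
  by move=> Ji; rewrite (AF i).2// (BF i).2// setIT.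
by rewrite bigcapI.
Qed.

Lemma sub_cylinders (T : Type) (I : eqType) (J : pred I)
    (F : I -> set (set T)) :
  (forall i, F i setT) -> \bigcup_(i in [set` J]) F i `<=` cylinders J F.
Proof.
move=> FT C [i Ji FC]; exists (fun j => if j == i then C else setT).
  by move=> j; case: eqP => [->|_]; split=> //; rewrite [J i]Ji.
apply/seteqP; split => [x Cx j _|x /(_ i Logic.I)]; last by rewrite eqxx.
by case: eqP.
Qed.

(** Cylinders over disjoint blocks multiply, since for each index at least
    one of the two factors is the full space; the pi-lambda argument,
    applied to one block and then to the other, carries this to the
    generated sigma-algebras. *)
Lemma mutually_independent_blocks (R : realType) (d : measure_display)
    (Omega : measurableType d) (P : probability Omega R) (I : finType)
    (F : I -> set (set Omega)) (J : pred I) (A B : set Omega) :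
  (forall i, setI_closed (F i)) -> (forall i, F i setT) ->
  (forall i, F i `<=` measurable) -> mutually_independent P F ->
  <<s \bigcup_(i in [set` J]) F i >> A ->
  <<s \bigcup_(i in [set` predC J]) F i >> B ->
  (P (A `&` B) = P A * P B)%E.
Proof.
move=> FI FT Fm indF sA sB.
have cm (K : pred I) : cylinders K F `<=` measurable.
  move=> _ [C CF ->]; rewrite bigcap_finType; apply: bigsetI_measurable => i _.
  exact/Fm/(CF i).1.
have scm (K : pred I) : <<s cylinders K F >> `<=` measurable.
  by apply: smallest_sub (cm K); exact: sigma_algebra_measurable.
have sub (K : pred I) : <<s \bigcup_(i in [set` K]) F i >> `<=` <<s cylinders K
  F >>.
  apply: smallest_sub; first exact: smallest_sigma_algebra.
  by apply: subset_trans (sub_cylinders _) _ => //; exact: sub_gen_smallest.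
apply: (@independent_of_generated _ _ _ P (cylinders J F)) (sub _ _ sA) => //.
- exact: cylinders_setI.
- exact: scm (sub _ _ sB).
move=> {sA}A JA; rewrite setIC muleC.
apply: (@independent_of_generated _ _ _ P (cylinders (predC J) F)) (sub _ _ sB)
  => //.
- exact: cylinders_setI.
- exact: cm JA.
move=> {sB}_ [C CF ->]; case: JA => {}A AF ->.
rewrite -bigcapI !indF//; last 3 first.
- by move=> i; exact: (AF i).1.
- by move=> i; exact: (CF i).1.
- by move=> i; apply: FI; [exact: (CF i).1|exact: (AF i).1].
rewrite -big_split/=; apply: eq_bigr => i _.
have [Ji|Ji] := boolP (J i).
- by rewrite (CF i).2/= ?Ji// setTI probability_setT mul1e.
- by rewrite (AF i).2// setIT probability_setT mule1.
Qed.

(** The rows multiply because the processes are independent, and the entries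
    of a row because they are increments of a single process. *)
Lemma mutually_independent_array (R : realType) (d : measure_display)
    (Omega : measurableType d) (P : probability Omega R) (I J : finType)
    (F : I -> set (set Omega)) (E : I -> J -> set (set Omega)) :
  (forall i, F i setT) -> (forall i, setI_closed (F i)) ->
  (forall i j, E i j `<=` F i) ->
  mutually_independent P F -> (forall i, mutually_independent P (E i)) ->
  mutually_independent P (fun p : I * J => E p.1 p.2).
Proof.
move=> FT FI EF indF indE A AE.
have -> : \bigcap_(p in [set: I * J]) A p =
    \bigcap_(i in [set: I]) \bigcap_(j in [set: J]) A (i, j).
  apply/seteqP; split=> [x Ax i _ j _|x Ax [i j] _]; first exact: Ax.
  exact: Ax.
rewrite indF; last first.
  move=> i; rewrite bigcap_finType; elim/big_ind : _ => // [|j _].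
  - by move=> X Y; exact: FI.
  - exact/EF/(AE (i, j)).
rewrite (eq_bigr (fun i => \prod_(j : J) P (A (i, j)))%E); last first.
  by move=> i _; rewrite (indE i (fun j => A (i, j)))// => j;
    exact: (AE (i, j)).
by rewrite pair_bigA/=; apply: eq_bigr => -[].
Qed.

Lemma integral_independent_pair (R : realType) (d d1 d2 : measure_display)
    (Omega : measurableType d) (T1 : measurableType d1) (T2 : measurableType d2)
    (P : probability Omega R) (X : {RV P >-> T1}) (Y : {RV P >-> T2})
    (f : T1 * T2 -> \bar R) :
  (forall A B, measurable A -> measurable B ->
    P (X @^-1` A `&` Y @^-1` B) = P (X @^-1` A) * P (Y @^-1` B))%E ->
  measurable_fun setT f -> (forall z, 0 <= f z)%E ->
  (\int[P]_w f (X w, Y w) = \int[P]_w \int[P]_w' f (X w, Y w'))%E.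
Proof.
move=> indXY mf f0.
have mXY : measurable_fun setT (fun w =>
  (X w, Y w)) by exact: measurable_fun_pair.
pose XY : {RV P >-> (T1 * T2)%type} := mfun_Sub (mem_set mXY).
have -> : (\int[P]_w f (X w, Y w) = \int[distribution P XY]_z f z)%E.
  by rewrite ge0_integral_distribution.
have -> : (\int[distribution P XY]_z f z =
    \int[(distribution P X \x distribution P Y)%E]_z f z)%E.
  apply: eq_measure_integral => A mA _; apply/esym.
  exact: product_measure_unique.
rewrite fubini_tonelli1// /fubini_F ge0_integral_distribution//=; last 2 first.
- exact: (measurable_fun_fubini_tonelli_F f).
- by move=> y; exact: integral_ge0.
apply: eq_integral => w _.
rewrite ge0_integral_distribution//.
apply: (measurableT_comp mf); exact: pair1_measurable.
Qed.

(** If [D] is independent of a sigma-algebra, quantities known to that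
    sigma-algebra may be held constant while integrating over [D]. This is
    Fubini's theorem for the pair (identity, [D]), the first component being
    read as a random element of the space with the coarser sigma-algebra. *)
Lemma integral_freezing (R : realType) (d : measure_display)
    (Omega : measurableType d) (P : probability Omega R)
    (G : set (set Omega)) (D : {RV P >-> R}) (A : set Omega)
    (V : Omega -> R) (h : R -> \bar R) :
  G `<=` measurable ->
  (forall B C, <<s G >> B -> measurable C ->
    P (B `&` D @^-1` C) = P B * P (D @^-1` C))%E ->
  <<s G >> A -> measurable_fun [set: g_sigma_algebraType G] V ->
  measurable_fun setT h -> (forall y, 0 <= h y)%E ->
  (\int[P]_(w in A) h (V w + D w)%R =
   \int[P]_(w in A) \int[P]_w' h (V w + D w')%R)%E.
Proof.
move=> Gm indD GA mV mh h0.
have sm : <<s G >> `<=` measurable.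
  by apply: smallest_sub => //; exact: sigma_algebra_measurable.
have mid : measurable_fun [set: Omega] (fun w : Omega =>
  (w : g_sigma_algebraType G)).
  by move=> _ B GB; rewrite setTI; exact: sm.
pose X : {RV P >-> g_sigma_algebraType G} := mfun_Sub (mem_set mid).
pose f (z : g_sigma_algebraType G * R) : \bar R :=
  ((\1_A z.1)%:E * h (V z.1 + z.2)%R)%E.
have mf : measurable_fun setT f.
  apply: emeasurable_funM.
    apply/measurable_EFinP; apply: measurableT_comp => //;
      exact: measurable_indic.
  apply: (measurableT_comp mh); apply: measurable_funD => //.
  exact: measurableT_comp.
have f0 z : (0 <= f z)%E by rewrite mule_ge0// lee_fin.
have := @integral_independent_pair _ _ _ _ _ _ _ _ X D f _ mf f0.
move=> fE; rewrite integral_mkcond [RHS]integral_mkcond.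
transitivity (\int[P]_w f (X w, D w))%E.
  apply: eq_integral => w _; rewrite /f/= patchE indicE.
  by case: ifPn; rewrite (mul1e, mul0e).
rewrite fE; last by move=> B C GB mC; exact: indD.
apply: eq_integral => w _; rewrite patchE; case: ifPn => wA.
  by apply: eq_integral => w' _; rewrite /f/= indicE wA mul1e.
by rewrite (@eq_integral _ _ _ _ _ (cst 0%E)) ?integral0// => w' _;
  rewrite /f/= indicE (negbTE wA) mul0e.
Qed.

(** * Gaussian laws *)

Import HBNNSimple.

(** Integration against a density, from simple functions by monotone
    convergence. *)
Lemma integral_normal_prob (R : realType) (m s : R)
    (f : measurableTypeR R -> \bar R) :
  measurable_fun setT f -> (forall x, 0 <= f x)%E ->
  (\int[normal_prob m s]_x f x =
   \int[lebesgue_measure]_x (f x * (normal_pdf m s x)%:E))%E.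
Proof.
move=> mf f0; pose f_ := nnsfun_approx measurableT mf.
have mpdf : measurable_fun setT (fun x : measurableTypeR R =>
  (normal_pdf m s x)%:E).
  by apply/measurable_EFinP; exact: measurable_normal_pdf.
transitivity (limn (fun n => \int[normal_prob m s]_x (f_ n x)%:E))%E.
  rewrite -monotone_convergence//=.
  - by apply: eq_integral => ? _; apply/esym/cvg_lim => //;
      exact: cvg_nnsfun_approx.
  - by move=> n; exact/measurable_EFinP/measurable_funTS.
  - by move=> n ? _; rewrite lee_fin fun_ge0.
  - by move=> ? _ ? ? mn; rewrite lee_fin; exact/lefP/nd_nnsfun_approx.
transitivity (limn (fun n =>
    \int[lebesgue_measure]_x ((f_ n x)%:E * (normal_pdf m s x)%:E)))%E;
      last first.
  rewrite -monotone_convergence//=.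
  - apply: eq_integral => x _;
      rewrite [LHS](_ : _ = limn (fun n =>
      (normal_pdf m s x)%:E * (f_ n x)%:E))%E.
      rewrite limeMl//; last by apply: ereal_nondecreasing_is_cvgn => i j ij;
      rewrite lee_fin; exact/lefP/nd_nnsfun_approx.
      by rewrite muleC; congr (_ * _)%E; apply/cvg_lim => //;
      exact: cvg_nnsfun_approx.
    by apply/congr_lim/funext => n; rewrite muleC.
  - move=> n; apply: emeasurable_funM => //; by apply/measurable_EFinP;
      apply: measurable_funTS.
  - by move=> n ? _; rewrite mule_ge0// lee_fin ?normal_pdf_ge0 ?fun_ge0.
  - move=> x _ i j ij; rewrite lee_wpmul2r// lee_fin ?normal_pdf_ge0//.
    exact/lefP/nd_nnsfun_approx.
apply/congr_lim/funext => n.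
rewrite integralT_nnsfun sintegralE.
under [RHS]eq_integral.
  move=> x _; rewrite fimfunE -fsumEFin// ge0_mule_fsuml; last first.
    by move=> r; rewrite EFinM nnfun_muleindic_ge0.
  over.
rewrite ge0_integral_fsum//; last 2 first.
- move=> r; apply: emeasurable_funM => //; apply/measurable_EFinP.
  exact: measurable_funM.
- by move=> r x _; rewrite mule_ge0 ?lee_fin ?normal_pdf_ge0// -lee_fin EFinM
    nnfun_muleindic_ge0.
apply: eq_fsbigr => r; rewrite inE/= => -[t _ tr].
have r0 : 0 <= r by rewrite -tr.
under [RHS]eq_integral do rewrite /= EFinM -muleA.
rewrite ge0_integralZl//; last 2 first.
- by apply: emeasurable_funM => //; exact/measurable_EFinP.
- by move=> x _; rewrite mule_ge0// lee_fin// normal_pdf_ge0.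
congr (_ * _)%E.
rewrite /= /normal_prob integral_mkcond; apply: eq_integral => x _.
by rewrite patchE indicE; case: ifPn; rewrite (mul1e, mul0e).
Qed.

Lemma lebesgue_measure_shift (R : realType) (c : R) (A : set
    (measurableTypeR R)) :
  measurable A ->
  pushforward lebesgue_measure
    (fun x => x + c : measurableTypeR R) A = lebesgue_measure A.
Proof.
move=> mA; apply/esym.
have mc : @measurable_fun _ _ (measurableTypeR R) (measurableTypeR R) setT (fun
  x => x + c).
  exact: measurable_funD.
pose f : {mfun measurableTypeR R >-> measurableTypeR R} :=
  @mfun_Sub _ _ (measurableTypeR R) (measurableTypeR R) _ (mem_set mc).
apply: (@lebesgue_measure_unique _ (pushforward lebesgue_measure f)) =>
  //= _ [[a b]] _ <-.
rewrite /pushforward/= (_ : _ @^-1` _ = `](a - c), (b - c)]%classic);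
  last first.
  by apply/seteqP; split => x /=; rewrite !in_itv/= lerBrDr ltrBlDr.
rewrite !lebesgue_measure_itv/= !lte_fin ltrD2r -!EFinB; case: ifP => // _.
by rewrite opprB addrA subrK.
Qed.

Lemma ge0_integral_shift (R : realType) (c : R)
    (f : measurableTypeR R -> \bar R) :
  measurable_fun setT f -> (forall x, 0 <= f x)%E ->
  (\int[lebesgue_measure]_x f (x + c)%R = \int[lebesgue_measure]_x f x)%E.
Proof.
move=> mf f0.
have mc : @measurable_fun _ _ (measurableTypeR R) (measurableTypeR R) setT (fun
  x => x + c).
  exact: measurable_funD.
have /= := ge0_integral_pushforward mc lebesgue_measure measurableT mf (fun x _
  => f0 x).
rewrite preimage_setT => <- //.
apply: eq_measure_integral => A mA _; exact: lebesgue_measure_shift.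
Qed.

Lemma ge0_integral_opp (R : realType) (f : measurableTypeR R -> \bar R) :
  measurable_fun setT f -> (forall x, 0 <= f x)%E ->
  (\int[lebesgue_measure]_x f (- x)%R = \int[lebesgue_measure]_x f x)%E.
Proof.
move=> mf f0.
have mc : @measurable_fun _ _ (measurableTypeR R) (measurableTypeR R) setT (fun
  x => - x).
  exact: oppr_measurable.
have /= := ge0_integral_pushforward mc lebesgue_measure measurableT mf (fun x _
  => f0 x).
rewrite preimage_setT => <- //.
apply: eq_measure_integral => A mA _; exact: lebesgue_measureN.
Qed.

(** Completing the square in [x]: as a function of [x], the product that
    appears in the convolution of two centred normal densities is a multiple
    of a normal density. Its integral over [x] is therefore known without
    computation. *)
Lemma normal_pdf_prod (R : realType) (s1 s2 x z : R) : s1 != 0 -> s2 != 0 ->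
  let s := Num.sqrt (s1 ^+ 2 + s2 ^+ 2) in
  normal_pdf 0 s1 x * normal_pdf 0 s2 (z - x) =
  normal_pdf 0 s z * normal_pdf (z * s1 ^+ 2 / s ^+ 2) (`|s1| * `|s2| / s) x.
Proof.
move=> s10 s20 s.
have s1p : 0 < s1 ^+ 2 by rewrite exprn_even_gt0.
have s2p : 0 < s2 ^+ 2 by rewrite exprn_even_gt0.
have sp : 0 < s by rewrite sqrtr_gt0 addr_gt0.
have sE : s ^+ 2 = s1 ^+ 2 + s2 ^+ 2 by rewrite sqr_sqrtr// addr_ge0// ltW.
have tp : `|s1| * `|s2| / s != 0 by rewrite gt_eqF// divr_gt0// mulr_gt0//
  normr_gt0.
have tE : (`|s1| * `|s2| / s) ^+ 2 = s1 ^+ 2 * s2 ^+ 2 / (s1 ^+ 2 + s2 ^+ 2).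
  by rewrite expr_div_n exprMn !real_normK ?num_real// sE.
rewrite !normal_pdfE// ?gt_eqF// mulrACA [RHS]mulrACA; congr (_ * _).
  rewrite /normal_peak -!invfM; congr (_^-1).
  have nn (a : R) : 0 <= a ^+ 2 * pi *+ 2 by rewrite mulrn_wge0// mulr_ge0
    ?pi_ge0 ?sqr_ge0.
  rewrite -(sqrtrM _ (nn s1)) -(sqrtrM _ (nn s)); congr (Num.sqrt _).
  rewrite tE sE; field.
  by rewrite gt_eqF// addr_gt0.
rewrite /normal_fun -!expRD; congr expR.
rewrite tE sE; field.
by rewrite s10 s20 gt_eqF// addr_gt0.
Qed.

(** Multiplying a normal density by an exponential translates it: the static
    form of Girsanov's change of drift. *)
Lemma normal_pdf_tilt (R : realType) (s l x : R) : s != 0 ->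
  expR (l * x) * normal_pdf 0 s x =
  expR (l ^+ 2 * s ^+ 2 / 2) * normal_pdf (l * s ^+ 2) s x.
Proof.
move=> s0; rewrite !normal_pdfE// mulrCA [RHS]mulrCA; congr (_ * _).
rewrite /normal_fun -!expRD; congr expR.
by field.
Qed.

Lemma normal_pdf_shift (R : realType) (m s x : R) :
  s != 0 -> normal_pdf m s (x + m) = normal_pdf 0 s x.
Proof. by move=> s0; rewrite !normal_pdfE// /normal_fun addrK subr0. Qed.

Lemma normal_pdf_even (R : realType) (s x : R) :
  s != 0 -> normal_pdf 0 s (- x) = normal_pdf 0 s x.
Proof. by move=> s0; rewrite !normal_pdfE// /normal_fun !subr0 sqrrN. Qed.

Lemma integral_normal_rv (R : realType) (d : measure_display)
    (Omega : measurableType d) (P : probability Omega R) (X : {RV P >-> R})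
    (m s : R) (g : R -> \bar R) :
  (forall A, measurable A -> P (X @^-1` A) = normal_prob m s A) ->
  measurable_fun setT g -> (forall x, 0 <= g x)%E ->
  (\int[P]_w g (X w) =
   \int[lebesgue_measure]_x (g x * (normal_pdf m s x)%:E))%E.
Proof.
move=> Xs mg g0.
rewrite -(integral_normal_prob m s mg g0).
have mX : @measurable_fun _ _ Omega (measurableTypeR R) setT X.
  move=> _ A mA; exact: (@measurable_funPT _ _ _ _ X measurableT A mA).
pose X' : {RV P >-> measurableTypeR R} :=
  @mfun_Sub _ _ _ (measurableTypeR R) _ (mem_set mX).
rewrite -[LHS](@ge0_integral_distribution _ _ _ (measurableTypeR R) _ P X' g)//.
by apply: eq_measure_integral => A mA _; exact: Xs.
Qed.

(** Variances add up. The integral over [x] in the convolution is evaluated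
    by [normal_pdf_prod] after exchanging the two integrals. *)
Lemma normal_rvD (R : realType) (d : measure_display)
    (Omega : measurableType d) (P : probability Omega R) (X Y : {RV P >-> R})
    (s1 s2 : R) :
  s1 != 0 -> s2 != 0 ->
  (forall A B, measurable A -> measurable B ->
    P (X @^-1` A `&` Y @^-1` B) = P (X @^-1` A) * P (Y @^-1` B))%E ->
  (forall A, measurable A -> P (X @^-1` A) = normal_prob 0 s1 A) ->
  (forall A, measurable A -> P (Y @^-1` A) = normal_prob 0 s2 A) ->
  forall A, measurable A ->
    P ((X \+ Y) @^-1` A) = normal_prob 0 (Num.sqrt (s1 ^+ 2 + s2 ^+ 2)) A.
Proof.
move=> s10 s20 indXY Xs Ys A mA.
set s := Num.sqrt _.
pose f (z : R * R) : \bar R := (\1_A (z.1 + z.2))%:E.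
have mf : measurable_fun setT f.
  apply/measurable_EFinP.
  by apply: (measurableT_comp (measurable_indic mA)); exact: measurable_funD.
have f0 z : (0 <= f z)%E by rewrite lee_fin.
have mpdf m t : measurable_fun setT (fun x : R => (normal_pdf m t x)%:E).
  by apply/measurable_EFinP; exact: measurable_normal_pdf.
pose f2 (z : R * R) : \bar R := (f z * (normal_pdf 0 s2 z.2)%:E)%E.
have mf2 : measurable_fun setT f2.
  by apply: emeasurable_funM => //; exact: (measurableT_comp (mpdf 0 s2)).
have f20 z : (0 <= f2 z)%E by rewrite mule_ge0// lee_fin normal_pdf_ge0.
pose f3 (z : R * R) : \bar R :=
  ((normal_pdf 0 s1 z.1)%:E * ((\1_A z.2)%:E * (normal_pdf 0 s2 (z.2 -
    z.1))%:E))%E.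
have mf3 : measurable_fun setT f3.
  apply: emeasurable_funM; first exact: (measurableT_comp (mpdf 0 s1)).
  apply: emeasurable_funM.
    by apply/measurable_EFinP; exact: (measurableT_comp (measurable_indic mA)).
  by apply: (measurableT_comp (mpdf 0 s2)); exact: measurable_funB.
have f30 z : (0 <= f3 z)%E by rewrite !mule_ge0// lee_fin normal_pdf_ge0.
transitivity (\int[P]_w f (X w, Y w))%E.
  have mXYA : measurable ((X \+ Y) @^-1` A).
    by rewrite -[X in measurable X]setTI; apply: measurable_funD.
  by have := integral_indic P measurableT mXYA; rewrite setIT => <-.
rewrite (integral_independent_pair indXY mf f0).
transitivity (\int[P]_w \int[lebesgue_measure]_y f2 (X w, y))%E.
  apply: eq_integral => w _.
  rewrite (integral_normal_rv (g := fun y => f (X w, y)) Ys)//.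
  exact: measurableT_comp.
rewrite (integral_normal_rv (g :=
  fun x => (\int[lebesgue_measure]_y f2 (x, y))%E) Xs)//; last 2 first.
  exact: (@measurable_fun_fubini_tonelli_F _ _ R (measurableTypeR R) R
    lebesgue_measure f2 mf2 f20).
  by move=> x; exact: integral_ge0.
transitivity (\int[lebesgue_measure]_x \int[lebesgue_measure]_z f3 (x, z))%E.
  apply: eq_integral => x _.
  have mf2x : measurable_fun setT (fun y =>
    f2 (x, y)) by exact: measurableT_comp.
  rewrite -(ge0_integral_shift (- x) mf2x)// muleC -ge0_integralZl//;
    last 2 first.
    by apply: (measurableT_comp mf2x); exact: measurable_funD.
    by rewrite lee_fin normal_pdf_ge0.
  by apply: eq_integral => z _; rewrite /f3 /f2 /f/= subrKC.
rewrite (@fubini_tonelli _ _ (measurableTypeR R) (measurableTypeR R) R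
  lebesgue_measure lebesgue_measure f3 mf3 f30) [RHS]/normal_prob
    [RHS]integral_mkcond.
apply: eq_integral => z _; rewrite patchE.
transitivity (\int[lebesgue_measure]_x
   (((\1_A z)%:E * (normal_pdf 0 s z)%:E) *
      (normal_pdf (z * s1 ^+ 2 / s ^+ 2) (`|s1| * `|s2| / s) x)%:E))%E.
  apply: eq_integral => x _.
  rewrite /f3/= muleCA -[RHS]muleA -!EFinM; congr ((_ * _)%:E).
  exact: normal_pdf_prod.
rewrite ge0_integralZl//; last 3 first.
- exact: mpdf.
- by move=> x _; rewrite lee_fin normal_pdf_ge0.
- by rewrite mule_ge0// lee_fin normal_pdf_ge0.
rewrite integral_normal_pdf mule1 indicE; case: ifPn; by rewrite (mul1e,mul0e).
Qed.

(** * Gaussian tails and the payoff of the reflection principle *)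

Definition normal_tail (R : realType) (s b : R) : R :=
  fine (normal_prob 0 s `]b, +oo[).

Lemma normal_tail_ge0 (R : realType) (s b : R) : 0 <= normal_tail s b.
Proof. by rewrite fine_ge0. Qed.

Lemma normal_prob_tail (R : realType) (m s b : R) : s != 0 ->
  normal_prob m s `]b, +oo[ = (normal_tail s (b - m))%:E.
Proof.
move=> s0; rewrite /normal_tail fineK; last by rewrite fin_num_measure.
rewrite /normal_prob [LHS]integral_mkcond [RHS]integral_mkcond.
pose f (m b : R) (x : measurableTypeR R) : \bar R :=
  ((fun x : R => (normal_pdf m s x)%:E) \_ `]b, +oo[) x.
rewrite -[LHS](@ge0_integral_shift _ m (f m b)).
- apply: eq_integral => x _; rewrite /f !patchE !mem_setE !in_itv/= !andbT.
  by rewrite ltrBlDr; case: ifP => // _; rewrite normal_pdf_shift.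
- apply/(measurable_restrictT _ _).1 => //; apply: measurable_funTS.
  by apply/measurable_EFinP; exact: measurable_normal_pdf.
- by move=> x; rewrite /f patchE; case: ifP => // _;
    rewrite lee_fin normal_pdf_ge0.
Qed.

Lemma normal_tailE (R : realType) (s b : R) :
  (normal_tail s b)%:E =
  (\int[lebesgue_measure]_x ((\1_(`]b,
    +oo[%classic : set R) x)%:E * (normal_pdf 0 s x)%:E))%E.
Proof.
rewrite /normal_tail fineK; last by rewrite fin_num_measure.
rewrite /normal_prob integral_mkcond; apply: eq_integral => x _.
by rewrite patchE indicE; case: ifPn => _; rewrite (mul1e, mul0e).
Qed.

(** Symmetry of the density, together with the absence of atoms. *)
Lemma normal_tail_opp (R : realType) (s b : R) : s != 0 ->
  normal_tail s (- b) = 1 - normal_tail s b.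
Proof.
move=> s0; apply/eqP; rewrite eq_sym subr_eq; apply/eqP.
apply: EFin_inj; rewrite EFinD.
have -> : (normal_tail s (- b))%:E = normal_prob 0 s `]-oo, b].
  rewrite normal_tailE -ge0_integral_opp//; last 2 first.
  - apply: emeasurable_funM; apply/measurable_EFinP;
      last exact: measurable_normal_pdf.
    exact: measurable_indic.
  - by move=> x; rewrite mule_ge0// lee_fin normal_pdf_ge0.
  rewrite /normal_prob.
  (* reflection turns the open half-line into an open one; the end point is
     negligible *)
  transitivity (\int[lebesgue_measure]_(x in `]-oo,
    b[) (normal_pdf 0 s x)%:E)%E; last first.
    apply: integral_itv_bndo_bndc.
    by apply/measurable_EFinP; apply: measurable_funTS;
      exact: measurable_normal_pdf.
  rewrite [RHS]integral_mkcond; apply: eq_integral => x _.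
  rewrite patchE indicE !mem_setE !in_itv/= andbT ltrN2 normal_pdf_even//.
  by case: ifP; rewrite (mul1e, mul0e).
rewrite /normal_tail fineK ?fin_num_measure// -measureU//.
- rewrite itv_setU_setT; exact/esym/integral_normal_pdf.
- by apply/seteqP; split => x //=; rewrite !in_itv/= andbT => -[] xb;
    rewrite ltNge xb.
Qed.

(** The density is bounded by its peak value. *)
Lemma normal_tail_lipschitz (R : realType) (s b e : R) : s != 0 -> 0 <= e ->
  normal_tail s b <= normal_tail s (b + e) + normal_peak s * e.
Proof.
move=> s0 e0; rewrite -lee_fin EFinD !fineK ?fin_num_measure//.
have -> : `]b, +oo[%classic = `]b, b + e] `|` `]b + e,
  +oo[ :> set (measurableTypeR R).
  apply/seteqP; split => x /=; rewrite !in_itv/= !andbT.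
    by move=> bx; rewrite bx/=; case: (leP x (b + e)) => _; [left|right].
  by move=> [/andP[]//|]; apply: le_lt_trans; rewrite lerDl.
rewrite measureU//; last first.
  apply/seteqP; split => x //=; rewrite !in_itv/= andbT => -[/andP[_]].
  by move=> xb; rewrite ltNge xb.
rewrite addeC; apply: leeD => //.
have mpdf : measurable_fun `]b, b + e] (fun x : measurableTypeR R =>
  (normal_pdf 0 s x)%:E).
  by apply: measurable_funTS; apply/measurable_EFinP;
    exact: measurable_normal_pdf.
have le_peak : (normal_prob 0 s `]b, (b + e)%R] <=
    \int[lebesgue_measure]_(x in `]b, (b + e)%R]) (normal_peak s)%:E)%E.
  apply: ge0_le_integral => //=.
  - by move=> x _; rewrite lee_fin normal_pdf_ge0.
  - by move=> x _; rewrite lee_fin normal_pdf_ub.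
apply: (le_trans le_peak);
  rewrite integral_cst//= lebesgue_measure_itv/= lte_fin.
case: ifP => _; first by rewrite -EFinB -EFinM lee_fin addrAC subrr add0r.
by rewrite mule0 lee_fin mulr_ge0// normal_peak_ge0.
Qed.

Lemma integral_exp_normal_tail (R : realType) (s b l : R) : s != 0 ->
  (\int[lebesgue_measure]_x
    (((\1_(`]b, +oo[%classic : set R) x) * expR (l * x))%:E * (normal_pdf 0 s
      x)%:E) =
   (expR (l ^+ 2 * s ^+ 2 / 2) * normal_tail s (b - l * s ^+ 2))%:E)%E.
Proof.
move=> s0; rewrite EFinM -normal_prob_tail// /normal_prob [in
  RHS]integral_mkcond.
rewrite -ge0_integralZl//; last 2 first.
- apply/(measurable_restrictT _ _).1 => //; apply: measurable_funTS.
  by apply/measurable_EFinP; exact: measurable_normal_pdf.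
- by move=> x _; rewrite patchE; case: ifP => // _;
    rewrite lee_fin normal_pdf_ge0.
apply: eq_integral => x _; rewrite patchE indicE.
case: ifP => _; last by rewrite mul0r mul0e mule0.
by rewrite mul1r -!EFinM normal_pdf_tilt.
Qed.

(** Final payoff of the reflection principle. The summand 1 counts the paths
    that end above the barrier, and [expR (th * y)] weighs them so that they
    also account for the paths that crossed the barrier and came back below
    it. *)
Definition barrier_payoff (R : realType) (th y : R) : R :=
  \1_(`]0, +oo[%classic : set R) y * (1 + expR (th * y)).

Lemma measurable_barrier_payoff (R : realType) (th : R) :
  measurable_fun setT (barrier_payoff th).
Proof.
apply: measurable_funM; first exact: measurable_indic.
apply: measurable_funD => //; apply: measurableT_comp => //.
Qed.

Lemma barrier_payoff_ge0 (R : realType) (th y : R) : 0 <= barrier_payoff th y.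
Proof. by rewrite mulr_ge0// addr_ge0// expR_ge0. Qed.

Lemma barrier_payoff_gt0 (R : realType) (th y : R) :
  0 < y -> barrier_payoff th y = 1 + expR (th * y).
Proof. by move=> y0; rewrite /barrier_payoff indicE mem_setE in_itv/= y0 mul1r.
  Qed.

Lemma barrier_payoff_le0 (R : realType) (th y : R) :
  y <= 0 -> barrier_payoff th y = 0.
Proof. by move=> y0; rewrite /barrier_payoff indicE mem_setE in_itv/= ltNge y0
  mul0r. Qed.

(** Here [k] is the drift accumulated while [D] accumulates its variance,
    and [th * s ^+ 2 = 2 * k] is the tilt that turns the drift [- k] into
    [k]. *)
Lemma integral_barrier_payoff (R : realType) (d : measure_display)
    (Omega : measurableType d) (P : probability Omega R) (D : {RV P >-> R})
    (s th k v : R) :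
  s != 0 -> th * s ^+ 2 = 2 * k ->
  (forall A, measurable A -> P (D @^-1` A) = normal_prob 0 s A) ->
  (\int[P]_w (barrier_payoff th (v + (D w - k)))%:E =
   (normal_tail s (k - v) + expR (th * v) * normal_tail s (- k - v))%:E)%E.
Proof.
move=> s0 thk Ds.
pose g (x : R) : \bar R := (barrier_payoff th (v + (x - k)))%:E.
have mg : measurable_fun setT g.
  apply/measurable_EFinP;
    apply: (measurableT_comp (@measurable_barrier_payoff _ _)).
  by apply: measurable_funD => //; exact: measurable_funB.
rewrite (integral_normal_rv (g := g) Ds)//; last first.
  by move=> x; rewrite lee_fin barrier_payoff_ge0.
pose I (x : R) := \1_(`]k - v, +oo[%classic : set R) x : R.
transitivity (\int[lebesgue_measure]_x ((I x)%:E * (normal_pdf 0 s x)%:E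
   + (expR (th * (v - k)))%:E * ((I x * expR (th * x))%:E * (normal_pdf 0 s
       x)%:E)))%E.
  apply: eq_integral => x _;
    rewrite /g /barrier_payoff /I !indicE !mem_setE !in_itv/= !andbT.
  rewrite [k - v < x](_ : _ = (0 < v + (x - k)));
    last by rewrite addrA subr_gt0 ltrBlDl.
  case: (0 < _); last by rewrite !mul0r !mul0e mule0 adde0.
  rewrite !mul1r -!EFinM -EFinD mulrDl mulrA -expRD; congr (_ + expR _ * _)%:E.
  by rewrite -mulrDr addrA addrAC.
have mI : measurable_fun setT I by exact: measurable_indic.
rewrite ge0_integralD//; last 4 first.
- by move=> x _; rewrite mule_ge0// lee_fin ?normal_pdf_ge0// /I indicE.
- apply: emeasurable_funM; apply/measurable_EFinP => //;
    exact: measurable_normal_pdf.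
- move=> x _; rewrite !mule_ge0// lee_fin ?normal_pdf_ge0 ?expR_ge0//.
  by rewrite mulr_ge0 ?expR_ge0// /I indicE.
- apply: emeasurable_funM => //; apply: emeasurable_funM;
    apply/measurable_EFinP; last exact: measurable_normal_pdf.
  apply: measurable_funM => //; apply: measurableT_comp => //;
    exact: measurable_funM.
rewrite -normal_tailE ge0_integralZl//; last 2 first.
- apply: emeasurable_funM; apply/measurable_EFinP;
    last exact: measurable_normal_pdf.
  apply: measurable_funM => //; apply: measurableT_comp => //;
    exact: measurable_funM.
- move=> x _; rewrite !mule_ge0// lee_fin ?normal_pdf_ge0//.
  by rewrite mulr_ge0 ?expR_ge0// /I indicE.
rewrite integral_exp_normal_tail// -EFinM -EFinD mulrA -expRD;
  congr (_ + expR _ * normal_tail _ _)%:E.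
  by rewrite (_ : th ^+ 2 * s ^+ 2 = th * (2 * k)); [field|rewrite -thk; ring].
by rewrite thk; ring.
Qed.

(** * Mills bounds *)

(** Used with [expR (k * x ^+ 2)] proportional to the normal density. *)
Lemma is_derive_gauss_div (R : realType) (c k x : R) : x != 0 ->
  is_derive x 1 (fun x : R => c * (x^-1 * expR (k * x ^+ 2)))
    (c * (2 * k - x ^- 2) * expR (k * x ^+ 2)).
Proof.
move=> x0.
have dq : is_derive x (1 : R) (k \*: ((@id R) ^+ 2)) (k *: ((2%:R * x ^+ 1) *:
  1)).
  by apply: is_deriveZ; apply: is_deriveX; exact: is_derive_id.
have de := is_derive1_comp (is_derive_expR _) dq.
have di := @is_deriveV _ id x 1 1 x0 (is_derive_id _ _).
have /= := is_deriveZ c (is_deriveM di de).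
rewrite (_ : _ \*: _ = (fun x : R => c * (x^-1 * expR (k * x ^+ 2))));
  last exact/funext.
move=> /is_derive_eq; apply.
rewrite /= /GRing.scale/= !fctE/= /GRing.scale/=; field.
exact: x0.
Qed.

(** The function pdf(x) (1 + s^2 / x^2) has the primitive - s^2 pdf(x) / x,
    so its integral over [b, +oo[ is s^2 pdf(b) / b; on that half-line it
    lies between the density and (1 + s^2 / b^2) times the density. *)
Lemma normal_tail_mills (R : realType) (s b : R) : 0 < s -> 0 < b ->
  normal_tail s b <= s ^+ 2 / b * normal_pdf 0 s b
    <= (1 + s ^+ 2 / b ^+ 2) * normal_tail s b.
Proof.
move=> s0 b0; set p := s ^+ 2 / b * _.
have s_neq0 : s != 0 by rewrite gt_eqF.
pose k : R := - (2 * s ^+ 2)^-1.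
have pdfE x : normal_pdf 0 s x = normal_peak s * expR (k * x ^+ 2).
  rewrite normal_pdfE// /normal_fun subr0; congr (_ * expR _).
  by rewrite /k -mulr_natl; field.
pose f (x : R) := normal_pdf 0 s x * (1 + s ^+ 2 / x ^+ 2).
(* the primitive - s^2 pdf(x) / x of f *)
pose F (x : R) : R := - (s ^+ 2 * normal_peak s) * (x^-1 * expR (k * x ^+ 2)).
have dF (x : R) : 0 < x -> is_derive x 1 F (f x).
  move=> x0; have xn0 : x != 0 by rewrite gt_eqF.
  apply: (@is_derive_eq _ _ _ _ _ _ _ _ (is_derive_gauss_div _ _ xn0)).
  rewrite /f pdfE [RHS]mulrAC; congr (_ * _); rewrite /k.
  by field; rewrite xn0 s_neq0.
have b_lt_gt0 x : b < x -> 0 < x by exact: lt_trans.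
have cpdf := @continuous_normal_pdf R 0 s s_neq0.
have cf (x : R) : 0 < x -> {for x, continuous f}.
  move=> x0; apply: continuousM; first exact: cpdf.
  apply: continuousD; first exact: cst_continuous.
  apply: continuousM; first exact: cst_continuous.
  by apply: continuousV; [rewrite expf_neq0// gt_eqF|exact: exprn_continuous].
have f0 x : b <= x -> 0 <= f x.
  by move=> bx; rewrite mulr_ge0 ?normal_pdf_ge0// addr_ge0// divr_ge0 ?sqr_ge0.
have Fb : - F b = p by rewrite /p pdfE /F; field; rewrite gt_eqF.
have cfw : {within `[b, +oo[, continuous f}.
  apply/continuous_within_itvcyP; split.
    by move=> x; rewrite in_itv/= andbT => /b_lt_gt0; exact: cf.
  exact/cvg_at_right_filter/cf.
have limF : F x @[x --> +oo] --> (0 : R).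
  rewrite -(mulr0 (- (s ^+ 2 * normal_peak s))); apply: cvgM;
    first exact: cvg_cst.
  apply: (@squeeze_cvgr _ _ _ _ (cst 0) (fun x : R => x^-1)); last 2 first.
  - exact: cvg_cst.
  - by apply/gtr0_cvgV0; [exact: nbhs_pinfty_gt|exact: cvg_id].
  near=> x; have x0 : 0 < x by [].
  rewrite /= mulr_ge0 ?expR_ge0 ?invr_ge0 ?(ltW x0)//=.
  rewrite ler_piMr ?invr_ge0 ?(ltW x0)// -[leRHS]expR0 ler_expR.
  by rewrite mulNr oppr_le0 mulr_ge0 ?sqr_ge0// invr_ge0 mulr_ge0 ?sqr_ge0.
have ddF x : b < x -> derivable F x 1 by move=> /b_lt_gt0 /dF[].
have Fright : F x @[x --> b^'+] --> F b.
  by apply/cvg_at_right_filter/differentiable_continuous/derivable1_diffP;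
    have [] := dF _ b0.
have F'E : {in `]b, +oo[, (derive1 F) =1 f}.
  move=> x; rewrite in_itv/= andbT => /b_lt_gt0 /dF dFx.
  by rewrite derive1E; apply: derive_val.
have intf : (\int[lebesgue_measure]_(x in `[b, +oo[) (f x)%:E = p%:E)%E.
  have -> := ge0_continuous_FTC2y f0 cfw limF ddF Fright F'E.
  by rewrite sub0e -EFinN Fb.
have tailE : (normal_tail s b)%:E = (\int[lebesgue_measure]_(x in `[b,
  +oo[) (normal_pdf 0 s x)%:E)%E.
  rewrite /normal_tail fineK ?fin_num_measure//; apply: integral_itv_obnd_cbnd.
  by apply/measurable_EFinP; apply: measurable_funTS;
    exact: measurable_normal_pdf.
have mpdf : measurable_fun `[b, +oo[ (fun x : measurableTypeR R =>
  (normal_pdf 0 s x)%:E).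
  by apply: measurable_funTS; apply/measurable_EFinP;
    exact: measurable_normal_pdf.
have mf : measurable_fun `[b, +oo[ (fun x : measurableTypeR R => (f x)%:E).
  by apply/measurable_EFinP; apply: subspace_continuous_measurable_fun.
have bx_gt0 x : b <= x -> 0 < x by exact: lt_le_trans.
apply/andP; split; rewrite -lee_fin.
  rewrite -intf tailE; apply: ge0_le_integral => //.
  - by move=> x _; rewrite lee_fin normal_pdf_ge0.
  - move=> x; rewrite /= in_itv/= andbT => bx; rewrite lee_fin.
    by rewrite ler_peMr ?normal_pdf_ge0// lerDl divr_ge0 ?sqr_ge0.
rewrite [leRHS]EFinM -intf tailE -ge0_integralZl//.
- apply: ge0_le_integral => //.
  - by move=> x; rewrite /= in_itv/= andbT => bx; rewrite lee_fin f0.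
  - exact: measurable_funeM.
  - move=> x; rewrite /= in_itv/= andbT => bx; rewrite lee_fin /f mulrC.
    rewrite ler_wpM2r ?normal_pdf_ge0// lerD2l ler_wpM2l ?sqr_ge0//.
    by rewrite lef_pV2 ?posrE ?exprn_gt0 ?bx_gt0// lerXn2r// nnegrE ltW//
      bx_gt0.
- by move=> x _; rewrite lee_fin normal_pdf_ge0.
- by rewrite lee_fin addr_ge0// divr_ge0 ?sqr_ge0.
Unshelve. all: by end_near. Qed.

(** * First passage of a discrete-time process *)

Lemma ge0_le_integral_pieces (R : realType) (d : measure_display)
    (T : measurableType d) (mu : {measure set T -> \bar R}) (I : finType)
    (F : I -> set T) (f g : T -> \bar R) :
  (forall i, measurable (F i)) -> trivIset setT F ->
  measurable_fun setT f -> measurable_fun setT g ->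
  (forall x, 0 <= f x)%E -> (forall x, 0 <= g x)%E ->
  (forall i, \int[mu]_(x in F i) f x <= \int[mu]_(x in F i) g x)%E ->
  (\int[mu]_(x in \bigcup_(i in [set: I]) F i) f x <=
   \int[mu]_(x in \bigcup_(i in [set: I]) F i) g x)%E.
Proof.
move=> mF tF mf mg f0 g0 fg.
have -> : \bigcup_(i in [set: I]) F i = \big[setU/set0]_(i <- index_enum I) F i.
  rewrite -bigcup_seq; apply: eq_bigcupl; split=> i //= _;
    exact: mem_index_enum.
have tI : trivIset [set` index_enum I] F by apply: sub_trivIset tF.
rewrite !ge0_integral_bigsetU ?index_enum_uniq//.
- exact: lee_sum.
- exact: measurable_funTS.
- exact: measurable_funTS.
Qed.

(** Generators of the sigma-algebra of the past, kept as a plain union so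
    that it can be compared with other generating families. *)
Definition past (R : realType) (d : measure_display) (Omega : measurableType d)
    (P : probability Omega R) (Y : nat ->
      {RV P >-> R}) (j : nat) : set (set Omega) :=
  \bigcup_(i in [set i | (i <= j)%N]) g_sigma_algebra_preimage (Y i).

Definition first_passage (R : realType) (d : measure_display)
    (Omega : measurableType d)
    (P : probability Omega R) (Y : nat -> {RV P >-> R}) (j : nat) : set Omega :=
  [set w | 0 < Y j w /\ forall i, (i < j)%N -> Y i w <= 0].

Lemma sub_past_measurable (R : realType) (d : measure_display)
    (Omega : measurableType d) (P : probability Omega R)
    (Y : nat -> {RV P >-> R}) (j : nat) : past Y j `<=` measurable.
Proof. by move=> _ [i _ [B mB <-]]; rewrite setTI;
  exact: measurable_funPTI. Qed.

Lemma sigma_past_measurable (R : realType) (d : measure_display)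
    (Omega : measurableType d) (P : probability Omega R)
    (Y : nat -> {RV P >-> R}) (j : nat) : <<s past Y j >> `<=` measurable.
Proof.
apply: smallest_sub; first exact: sigma_algebra_measurable.
exact: sub_past_measurable.
Qed.

Lemma measurable_fun_past (R : realType) (d : measure_display)
    (Omega : measurableType d) (P : probability Omega R)
    (Y : nat -> {RV P >-> R}) (i j : nat) : (i <= j)%N ->
  measurable_fun [set: g_sigma_algebraType (past Y j)] (Y i).
Proof.
move=> ij _ B mB; apply: sub_gen_smallest; exists i => //.
by exists B.
Qed.

Lemma first_passage_in_past (R : realType) (d : measure_display)
    (Omega : measurableType d) (P : probability Omega R)
    (Y : nat -> {RV P >-> R}) (j : nat) : <<s past Y j >> (first_passage Y j).
Proof.
have -> : first_passage Y j =
    (Y j @^-1` `]0, +oo[) `&` \bigcap_(i in [set i | (i < j)%N]) (Y i @^-1`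
      `]-oo, 0]).
  apply/seteqP; split=> [w [Y0 Yi]|w [/= Y0 Yi]]; split => /=.
  - by rewrite in_itv/= andbT.
  - by move=> i ij /=; rewrite in_itv/= Yi.
  - by move: Y0; rewrite in_itv/= andbT.
  - by move=> i ij; have /= := Yi _ ij; rewrite in_itv.
have mYi i B : (i <= j)%N -> measurable B ->
    @measurable _ (g_sigma_algebraType (past Y j)) (Y i @^-1` B).
  by move=> ij mB; rewrite -[X in measurable X]setTI;
    exact: measurable_fun_past.
apply: (@measurableI _ (g_sigma_algebraType (past Y j))); first exact: mYi.
apply: (@bigcap_measurableType _ (g_sigma_algebraType (past Y j))) => i /= ij.
by apply: mYi => //; exact: ltnW.
Qed.

Lemma trivIset_first_passage (R : realType) (d : measure_display)
    (Omega : measurableType d) (P : probability Omega R)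
    (Y : nat -> {RV P >-> R}) : trivIset setT (first_passage Y).
Proof.
move=> i j _ _ [w [[Yi0 Yi] [Yj0 Yj]]]; have [ij|ji|//] := ltngtP i j.
- by have := Yj _ ij; rewrite leNgt Yi0.
- by have := Yi _ ji; rewrite leNgt Yj0.
Qed.

(** A passage at some time is a first passage at the least such time. *)
Lemma bigcup_first_passage (R : realType) (d : measure_display)
    (Omega : measurableType d) (P : probability Omega R)
    (Y : nat -> {RV P >-> R}) (n : nat) :
  \bigcup_(j in [set: 'I_n.+1]) first_passage Y j =
  [set w | exists2 j, (j <= n)%N & 0 < Y j w].
Proof.
apply/seteqP; split=> [w [j _ [Y0 _]]|w /= [j jn Y0]].
  by exists j => //; rewrite -ltnS.
have ex : exists i, 0 < Y i w by exists j.
case: (ex_minnP ex) => i Yi mini.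
have ij : (i <= j)%N by exact: mini.
have i_lt : (i < n.+1)%N by rewrite ltnS (leq_trans ij).
exists (Ordinal i_lt) => //; split => //= k ki; rewrite leNgt;
  apply/negP => /mini.
by rewrite leqNgt ki.
Qed.

(** Independence of the past and the remaining increment, for the single
    horizon [n]: this much of the Markov property is enough for the
    reflection argument. *)
Definition forgets_past (R : realType) (d : measure_display)
    (Omega : measurableType d)
    (P : probability Omega R) (Y : nat -> {RV P >-> R}) (n : nat) : Prop :=
  forall j, (j <= n)%N -> forall A C, <<s past Y j >> A -> measurable C ->
    (P (A `&` (Y n \- Y j)%R @^-1` C) = P A * P ((Y n \- Y j)%R @^-1` C))%E.

Lemma integral_past_freezing (R : realType) (d : measure_display)
    (Omega : measurableType d)
    (P : probability Omega R) (Y : nat -> {RV P >-> R}) (n : nat) (h : R -> R)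
    (j : nat) (A : set Omega) :
  forgets_past Y n -> measurable_fun setT h -> (forall y, 0 <= h y) ->
  (j <= n)%N -> <<s past Y j >> A ->
  (\int[P]_(w in A) (h (Y n w))%:E =
   \int[P]_(w in A) \int[P]_w' (h (Y j w + (Y n w' - Y j w'))%R)%:E)%E.
Proof.
move=> fY mh h0 jn pA.
have mD : measurable_fun setT (Y n \- Y j) by exact: measurable_funB.
pose D : {RV P >-> R} := mfun_Sub (mem_set mD).
pose g (x : R) := (h x)%:E.
have mg : measurable_fun setT g by exact/measurable_EFinP.
have /= <- := @integral_freezing _ _ _ P (past Y j) D A (Y j) g
  (@sub_past_measurable _ _ _ _ _ _) (fY j jn) pA (@measurable_fun_past _ _ _ _
    _ _ _ (leqnn j)) mg _.
  by apply: eq_integral => w _ /=; rewrite /g subrKC.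
by move=> y; rewrite lee_fin.
Qed.

Lemma measurable_future_mean (R : realType) (d : measure_display)
    (Omega : measurableType d)
    (P : probability Omega R) (D V : {RV P >-> R}) (h : R -> R) :
  measurable_fun setT h -> (forall y, 0 <= h y) ->
  measurable_fun setT (fun w => \int[P]_w' (h (V w + D w')%R)%:E)%E.
Proof.
move=> mh h0.
pose f (z : R * Omega) : \bar R := (h (z.1 + D z.2))%:E.
have mf : measurable_fun setT f.
  apply/measurable_EFinP; apply: (measurableT_comp mh);
    apply: measurable_funD => //.
  exact: measurableT_comp.
have f0 z : (0 <= f z)%E by rewrite lee_fin.
have mF := measurable_fun_fubini_tonelli_F (m2 := P) f mf f0.
exact: (measurableT_comp mF).
Qed.

(** Decomposing over the first passage time [j]: the past being frozen, a
    path that has just passed, at [v > 0], has a mean payoff of at least 1. *)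
Lemma passage_le_integral (R : realType) (d : measure_display)
    (Omega : measurableType d)
    (P : probability Omega R) (Y : nat -> {RV P >-> R}) (n : nat) (h : R -> R) :
  forgets_past Y n -> measurable_fun setT h -> (forall y, 0 <= h y) ->
  (forall j v, (j <= n)%N -> 0 < v ->
    (1 <= \int[P]_w (h (v + (Y n w - Y j w))%R)%:E)%E) ->
  (P [set w | exists2 j, (j <= n)%N & (0 < Y j w)%R] <=
   \int[P]_w (h (Y n w))%:E)%E.
Proof.
move=> fY mh h0 hge.
have mhY : measurable_fun setT (fun w => (h (Y n w))%:E).
  by apply/measurable_EFinP; exact: measurableT_comp.
have mF (j : 'I_n.+1) : measurable (first_passage Y j).
  exact: sigma_past_measurable (@first_passage_in_past _ _ _ _ Y j).
rewrite -bigcup_first_passage; set E := \bigcup_(_ in _) _.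
have mE : measurable E by apply: fin_bigcup_measurable => //;
  exact: finite_finset.
apply: (@le_trans _ _ (\int[P]_(w in E) (h (Y n w))%:E)%E); last first.
  by apply: ge0_subset_integral => // w _; rewrite lee_fin.
rewrite -[P E]mul1e -integral_cst//.
apply: ge0_le_integral_pieces => //.
- move=> i j _ _ FF; apply/val_inj.
  exact: (@trivIset_first_passage _ _ _ _ Y _ _ Logic.I Logic.I FF).
- by move=> w; rewrite lee_fin.
move=> j; have jn : (j <= n)%N by rewrite -ltnS.
rewrite (integral_past_freezing fY mh h0 jn (@first_passage_in_past _ _ _ _ Y
  j)).
apply: ge0_le_integral => //.
- apply: measurable_funTS.
  have mD : measurable_fun setT (Y n \- Y j) by exact: measurable_funB.
  exact: (@measurable_future_mean _ _ _ P (mfun_Sub (mem_set mD)) (Y j)).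
- by move=> w [Yj0 _]; exact: hge.
Qed.

(** Converse decomposition. A path with no passage has no payoff; a path
    that lands at height at most [e] has a mean payoff of at most 1; the
    paths that overshoot [e] are collected in [O]. *)
Lemma integral_le_passage (R : realType) (d : measure_display)
    (Omega : measurableType d)
    (P : probability Omega R) (Y : nat -> {RV P >-> R}) (n : nat) (h : R -> R)
    (e : R) (O : set Omega) :
  forgets_past Y n -> measurable_fun setT h -> (forall y, 0 <= h y) ->
  (forall y, y <= 0 -> h y = 0) ->
  (forall j v, (j <= n)%N -> v <= e ->
    (\int[P]_w (h (v + (Y n w - Y j w))%R)%:E <= 1)%E) ->
  measurable O ->
  (forall j w, (j <= n)%N -> first_passage Y j w -> e < Y j w -> O w) ->
  (\int[P]_w (h (Y n w))%:E <=
   P [set w | exists2 j, (j <= n)%N & (0 < Y j w)%R] +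
   \int[P]_(w in O) (h (Y n w))%:E)%E.
Proof.
move=> fY mh h0 hy hle mO OE.
pose g w := (h (Y n w))%:E.
have g0 w : (0 <= g w)%E by rewrite lee_fin.
have mg : measurable_fun setT g.
  by apply/measurable_EFinP; exact: measurableT_comp.
(* first passages at j that do not overshoot e *)
pose F (j : 'I_n.+1) := first_passage Y j `&` (Y j @^-1` `]-oo, e]).
have pF (j : 'I_n.+1) : <<s past Y j >> (F j).
  apply: (@measurableI _ (g_sigma_algebraType (past Y j))).
    exact: (@first_passage_in_past _ _ _ _ Y j).
  by rewrite -[X in measurable X]setTI; exact: measurable_fun_past.
have mF j : measurable (F j) by exact: sigma_past_measurable (pF j).
set U := \bigcup_(j in [set: 'I_n.+1]) F j.
have mU : measurable U by apply: fin_bigcup_measurable => //;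
  exact: finite_finset.
set E := [set w | _].
have UE : U `<=` E.
  by move=> w [j _ [[Yj _] _]]; exists j => //; rewrite -ltnS.
have mE : measurable E.
  rewrite /E -bigcup_first_passage; apply: fin_bigcup_measurable;
    first exact: finite_finset.
  by move=> j _; exact: sigma_past_measurable (@first_passage_in_past _ _ _ _ Y
    j).
have U_le : (\int[P]_(w in U) g w <= P E)%E.
  apply: (@le_trans _ _ (P U)); last by rewrite le_measure ?inE.
  rewrite -[P U]mul1e -integral_cst//.
  apply: ge0_le_integral_pieces => //.
    move=> i j _ _ [w [[Fi _] [Fj _]]]; apply/val_inj.
    by apply: (@trivIset_first_passage _ _ _ _ Y _ _ Logic.I Logic.I); exists w.
  move=> j; have jn : (j <= n)%N by rewrite -ltnS.
  rewrite (integral_past_freezing fY mh h0 jn (pF j)).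
  apply: ge0_le_integral => //.
  - by move=> w _; apply: integral_ge0 => w' _; rewrite lee_fin.
  - apply: measurable_funTS.
    have mD : measurable_fun setT (Y n \- Y j) by exact: measurable_funB.
    exact: (@measurable_future_mean _ _ _ P (mfun_Sub (mem_set mD)) (Y j)).
  - by move=> w [_ /=]; rewrite in_itv/= => Yje; exact: hle.
rewrite -[X in (X <= _)%E]/(\int[P]_(w in setT) g w)%E -(setUv O)
  ge0_integral_setU//; last 3 first.
- exact: measurableC.
- by rewrite setUv.
- by rewrite disj_set2E setICr.
rewrite addeC; apply: leeD => //; apply: le_trans U_le.
rewrite [leLHS]integral_mkcond [leRHS]integral_mkcond.
apply: ge0_le_integral => //.
- by move=> w _; apply: erestrict_ge0.
- apply/(measurable_restrictT _ _).1;
    [exact: measurableC|exact: measurable_funTS].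
- by apply/(measurable_restrictT _ _).1 => //; exact: measurable_funTS.
- move=> w _; rewrite !patchE; case: ifPn => [|_]; last by case: ifP => // _;
    exact: g0.
  rewrite inE /= => nOw; case: ifPn => //; rewrite notin_setE => nUw.
  rewrite /g hy// leNgt; apply/negP => Yn0.
  have : E w by exists n.
  rewrite /E -bigcup_first_passage => -[j _ fj].
  apply: nUw; exists j => //; split => //=; rewrite in_itv/= leNgt;
    apply/negP => ej.
  by apply: nOw; apply: (OE j) => //; rewrite -ltnS.
Qed.

(** * Refining grids along continuous paths *)

(** Dominated convergence for indicators. *)
Lemma cvg_integral_sets (R : realType) (d : measure_display)
    (T : measurableType d) (mu : {measure set T -> \bar R})
    (g : T -> \bar R) (A_ : (set T)^nat) (A : set T) :
  mu.-integrable setT g -> (forall x, 0 <= g x)%E ->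
  (forall m, measurable (A_ m)) -> measurable A ->
  (forall x, \forall m \near \oo, A_ m x <-> A x) ->
  (\int[mu]_(x in A_ m) g x @[m --> \oo] --> \int[mu]_(x in A) g x)%E.
Proof.
move=> ig g0 mA_ mA AA.
have mg := measurable_int _ ig.
have mr (B : set T) : measurable B -> measurable_fun setT (g \_ B).
  by move=> mB; apply/(measurable_restrictT _ _).1 => //;
    exact: measurable_funTS.
have [] := @dominated_convergence _ _ _ mu setT measurableT
  (fun m => g \_ (A_ m)) (g \_ A) g (fun m => mr _ (mA_ m)) (mr _ mA).
- apply: aeW => x _; apply: cvg_near_cst.
  near=> m; have iffA : A_ m x <-> A x by near: m; exact: AA.
  by rewrite !patchE; congr (if _ then _ else _); apply/idP/idP;
    rewrite !inE => /iffA.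
- exact: ig.
- apply: aeW => x m _; rewrite patchE; case: ifP => _;
    first by rewrite gee0_abs.
  by rewrite abse0.
- move=> _ _; rewrite [in X in _ -> X]integral_mkcond.
  by under eq_fun do rewrite -integral_mkcond.
Unshelve. all: by end_near. Qed.

(** The parameter [m] counts [m.+1] steps, so that there is always at least
    one. *)
Definition grid (R : realType) (T : R) (m i : nat) : R := i%:R * (T / m.+1%:R).

Lemma gridS (R : realType) (T : R) (m i : nat) :
  grid T m i.+1 = grid T m i + T / m.+1%:R.
Proof. by rewrite /grid -(natr1 i) mulrDl mul1r. Qed.

(** Uniform continuity on [0, T], obtained from the near-covering form of
    compactness. *)
Lemma grid_uniform_continuity (R : realType) (T e : R) (f : R -> R) :
  0 < T -> 0 < e -> {within `[0, +oo[, continuous f} ->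
  \forall m \near \oo, forall s t, 0 <= s -> 0 <= t <= T ->
    `|s - t| <= T / m.+1%:R -> `|f s - f t| < e.
Proof.
move=> T0 e0 cf.
(* the property to be made uniform in t; s ranges over times at most one mesh
   away *)
pose Q (m : nat) (t : R) := 0 <= t ->
  forall s, 0 <= s -> `|s - t| <= T / m.+1%:R -> `|f s - f t| < e.
have cover : forall x, `[0, T]%classic x ->
    \forall x' \near x & m \near \oo, Q m x'.
  move=> x /=; rewrite in_itv/= => /andP[x0 _].
  have : `[0, +oo[%classic x by rewrite /= in_itv/= x0.
  move=> /nbhs_subspace_in nbx.
  have e2 : 0 < e / 2 by rewrite divr_gt0.
  have [/= d d0 fd] : within `[0, +oo[ (nbhs x) [set t | `|f x - f t| < e / 2].
    by rewrite nbx; move/cvgrPdist_lt : (cf x) => /(_ _ e2).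
  have half_d : 0 < d / 2 by rewrite divr_gt0.
  have mesh : \forall m \near \oo, T / m.+1%:R < d / 2.
    exists (Num.truncn (T / (d / 2))) => // m /= mN.
    rewrite ltr_pdivrMr// mulrC -ltr_pdivrMr// (lt_le_trans (truncnS_gt _))//
      ler_nat.
    by rewrite ltnS.
  exists (ball x (d / 2), [set m | T / m.+1%:R < d / 2]);
    first by split => //; exact: nbhsx_ballx.
  move=> [t m] [/= xt Tm] t0 s s0 st.
  have ft : `|f x - f t| < e / 2.
    apply: fd; last by rewrite /= in_itv/= t0.
    by apply: lt_trans xt _; lra.
  have fs : `|f x - f s| < e / 2.
    apply: fd; last by rewrite /= in_itv/= s0.
    rewrite /= (_ : x - s = (x - t) + (t - s)); last by ring.
    apply: le_lt_trans (ler_normD _ _) _; rewrite (distrC t s).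
    have xt' : `|x - t| < d / 2 by [].
    have Td : T / m.+1%:R < d / 2 by [].
    have std := le_lt_trans st Td.
    by rewrite [ltRHS](splitr d) ltrD.
  rewrite (_ : f s - f t = (f x - f t) - (f x - f s)); last by ring.
  apply: le_lt_trans (ler_normB _ _) _; lra.
have : \forall m \near \oo, `[0, T] `<=` Q m.
  by move/compact_near_coveringP : (@segment_compact R 0 T); apply.
apply: filterS => m Qm s t s0 /andP[t0 tT] st.
by apply: (Qm t) => //=; rewrite in_itv/= t0.
Qed.

Lemma grid_passage (R : realType) (T : R) (f : R -> R) :
  0 < T -> {within `[0, +oo[, continuous f} ->
  (exists2 t, 0 <= t <= T & 0 < f t) ->
  \forall m \near \oo, exists2 j, (j <= m.+1)%N & 0 < f (grid T m j).
Proof.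
move=> T0 cf [t /andP[t0 tT] ft].
have := grid_uniform_continuity T0 ft cf.
apply: filterS => m fm.
have mesh : 0 < T / m.+1%:R by rewrite divr_gt0.
(* the last grid time before t is within one mesh of it *)
set y := t / (T / m.+1%:R).
have y0 : 0 <= y by rewrite divr_ge0// ltW.
have /andP[jy yj] := truncn_itv y0.
exists (Num.truncn y).
  rewrite -(@ler_nat R) (le_trans jy)// ler_pdivrMr// mulrC divfK//.
have gt : grid T m (Num.truncn y) <= t by rewrite /grid -ler_pdivlMr.
have tg : t < grid T m (Num.truncn y) + T / m.+1%:R.
  by rewrite -gridS /grid -ltr_pdivrMr.
have := fm (grid T m (Num.truncn y)) t.
rewrite {1}/grid mulr_ge0 ?(ltW mesh)// t0 tT => /(_ isT isT).
have dist_tg : `|grid T m (Num.truncn y) - t| <= T / m.+1%:R.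
  by rewrite distrC ger0_norm ?subr_ge0// lerBlDl ltW.
move=> /(_ dist_tg); rewrite ltr_distl => /andP[]; lra.
Qed.

(** At its first passage on the grid, the path has crossed 0 within one
    mesh, hence cannot have risen by more than its modulus of continuity. *)
Lemma grid_overshoot (R : realType) (T e : R) (f : R -> R) :
  0 < T -> 0 < e -> {within `[0, +oo[, continuous f} -> f 0 <= 0 ->
  \forall m \near \oo, forall j, (j <= m.+1)%N ->
    (forall i, (i < j)%N -> f (grid T m i) <= 0) -> f (grid T m j) <= e.
Proof.
move=> T0 e0 cf f0; have := grid_uniform_continuity T0 e0 cf.
apply: filterS => m fm [_ _|j jm fi].
  by rewrite /grid mul0r (le_trans f0)// ltW.
have mesh : 0 < T / m.+1%:R by rewrite divr_gt0.
have g0 i : 0 <= grid T m i by rewrite mulr_ge0// ltW.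
have gT : grid T m j <= T.
  rewrite /grid mulrCA ler_piMr ?(ltW T0)// ler_pdivrMr// mul1r ler_nat.
  exact: leq_trans (ltnW jm) _.
have := fm (grid T m j.+1) (grid T m j) (g0 _); rewrite g0 gT => /(_ isT).
rewrite {1}gridS addrAC subrr add0r ger0_norm ?(ltW mesh)// lexx => /(_ isT).
rewrite ltr_distl => /andP[_].
by have := fi j (leqnn _); lra.
Qed.

(** By continuity, the passage can be detected on countably many grid times. *)
Lemma measurable_passage (R : realType) (d : measure_display)
    (Omega : measurableType d) (T : R) (X : R -> Omega -> R) :
  0 < T -> (forall t, measurable_fun setT (X t)) ->
  (forall w, {within `[0, +oo[, continuous (fun t => X t w)}) ->
  measurable [set w | exists2 t, 0 <= t <= T & 0 < X t w].
Proof.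
move=> T0 mX cX.
have -> : [set w | exists2 t, 0 <= t <= T & 0 < X t w] =
    \bigcup_m \bigcup_(j in [set j | (j <= m.+1)%N])
      (X (grid T m j) @^-1` `]0, +oo[).
  apply/seteqP; split => [w|w [m _ [j /= jm]]].
    move=> /(@grid_passage _ T (fun t =>
      X t w) T0 (@cX w))[m _ /(_ m (leqnn m))].
    by move=> [j jm Xj]; exists m => //; exists j => //=;
      rewrite in_itv/= andbT.
  rewrite in_itv/= andbT => Xj; exists (grid T m j) => //.
  rewrite /grid mulr_ge0 ?divr_ge0 ?(ltW T0)//=.
  by rewrite mulrCA ler_piMr ?(ltW T0)// ler_pdivrMr// mul1r ler_nat.
apply: bigcup_measurable => m _; apply: bigcup_measurable => j _.
by rewrite -[X in measurable X]setTI; exact: mX.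
Qed.

(** * Passage of a drifted Brownian motion *)

Lemma normal_tail_antitone (R : realType) (s b b' : R) :
  b <= b' -> normal_tail s b' <= normal_tail s b.
Proof.
move=> bb'; rewrite fine_le ?fin_num_measure// le_measure ?inE//.
by apply: subset_itvr; rewrite bnd_simp.
Qed.

(** At [v = 0] the expression is [normal_tail s k + normal_tail s (- k)],
    which is 1, and it is nondecreasing in [v]. *)
Lemma payoff_mean_ge1 (R : realType) (s th k v : R) :
  s != 0 -> 0 <= th -> 0 <= v ->
  1 <= normal_tail s (k - v) + expR (th * v) * normal_tail s (- k - v).
Proof.
move=> s0 th0 v0; rewrite -lerBlDl.
have tk := @normal_tail_antitone R s (k - v) k.
rewrite gerBl// in tk.
apply: (@le_trans _ _ (normal_tail s (- k))).
  by rewrite normal_tail_opp// lerB// tk.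
apply: (@le_trans _ _ (normal_tail s (- k - v))).
  by apply: normal_tail_antitone; rewrite gerBl.
by rewrite ler_peMl ?normal_tail_ge0// -expR0 ler_expR mulr_ge0.
Qed.

Lemma payoff_mean_le1 (R : realType) (s th k v : R) :
  s != 0 -> 0 <= th -> v <= 0 ->
  normal_tail s (k - v) + expR (th * v) * normal_tail s (- k - v) <= 1.
Proof.
move=> s0 th0 v0; rewrite -lerBrDl.
apply: (@le_trans _ _ (normal_tail s (- k))); last first.
  by rewrite normal_tail_opp// lerB// normal_tail_antitone// lerBrDr gerDl.
apply: (@le_trans _ _ (normal_tail s (- k - v))); last first.
  by apply: normal_tail_antitone; rewrite lerBrDr gerDl.
by rewrite ler_piMl ?normal_tail_ge0// -expR0 ler_expR mulr_ge0_le0.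
Qed.

(** Brownian motion with variance [nu * t] at time [t], with the
    independence of its increments in the only form used below. *)
Record scaled_brownian_motion (R : realType) (d : measure_display)
    (Omega : measurableType d) (P : probability Omega R) (nu : R)
    (W : R -> {RV P >-> R}) : Prop := ScaledBrownianMotion {
  scaled_start : forall w, W 0 w = 0;
  scaled_gaussian : forall s t, 0 <= s -> s < t -> forall A, measurable A ->
    P ((W t \- W s) @^-1` A) = normal_prob 0 (Num.sqrt (nu * (t - s))) A;
  scaled_markov : forall (t : nat -> R) (n : nat), 0 <= t 0%N ->
    nondecreasing_seq t -> forgets_past (W \o t) n;
  scaled_continuous : forall w,
    {within `[0, +oo[, continuous (fun t => W t w)}
}.

(** Deterministic translations change neither the sigma-algebra of the past
    nor the independence of the increments. *)
Lemma forgets_past_shift (R : realType) (d : measure_display)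
    (Omega : measurableType d) (P : probability Omega R)
    (Y Z : nat -> {RV P >-> R}) (c : nat -> R) (n : nat) :
  (forall i w, Y i w = Z i w - c i) -> forgets_past Z n -> forgets_past Y n.
Proof.
move=> YZ fZ j jn A C pA mC.
have msub (r : R) B : measurable B -> measurable ((fun x : R => x - r) @^-1` B).
  by move=> mB; rewrite -[X in measurable X]setTI; apply: measurable_funB.
have -> : (Y n \- Y j) @^-1` C = (Z n \- Z j) @^-1` ((fun x =>
  x - (c n - c j)) @^-1` C).
  have DE w : Y n w - Y j w = Z n w - Z j w - (c n - c j) by rewrite !YZ; ring.
  by apply/seteqP; split=> w /=; rewrite DE.
apply: fZ => //; last exact: msub.
move: A pA; apply: sub_smallest2r; first exact: smallest_sigma_algebra.
move=> _ [i /= ij [B mB <-]]; exists i => //.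
exists ((fun x => x - c i) @^-1` B); first exact: msub.
by rewrite !setTI; apply/seteqP; split=> w /=; rewrite YZ.
Qed.

(** Probability that a Brownian motion with variance [nu * t] crosses the
    line [mu * t + x] before time [T]; see [passage_probability]. *)
Definition passage_formula (R : realType) (nu mu T x : R) : R :=
  normal_tail (Num.sqrt (nu * T)) (mu * T + x) +
  expR (- (2 * mu / nu) * x) * normal_tail (Num.sqrt (nu * T)) (x - mu * T).

(** Choosing [th = 2 * mu / nu] makes the tilt match the drift [mu] on every
    time interval at once, since drift and variance are both proportional to
    its length. *)
Lemma increment_payoff (R : realType) (d : measure_display)
    (Omega : measurableType d) (P : probability Omega R) (nu mu : R)
    (W : R -> {RV P >-> R}) (s t v : R) :
  scaled_brownian_motion nu W -> 0 < nu -> 0 <= s -> s < t ->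
  (\int[P]_w (barrier_payoff (2 * mu / nu)
      (v + (W t w - W s w - mu * (t - s))))%:E =
   (normal_tail (Num.sqrt (nu * (t - s))) (mu * (t - s) - v) +
    expR (2 * mu / nu * v) *
      normal_tail (Num.sqrt (nu * (t - s))) (- (mu * (t - s)) - v))%:E)%E.
Proof.
move=> BW nu0 s0 st.
have mD : measurable_fun setT (W t \- W s) by exact: measurable_funB.
have nts : 0 < nu * (t - s) by rewrite mulr_gt0// subr_gt0.
apply: (@integral_barrier_payoff _ _ _ P (mfun_Sub (mem_set mD))).
- by rewrite gt_eqF// sqrtr_gt0.
- by rewrite sqr_sqrtr ?ltW//; field; rewrite gt_eqF.
- exact: (scaled_gaussian BW).
Qed.

Section passage.
Context (R : realType) (d : measure_display).
Context (Omega : measurableType d) (P : probability Omega R) (nu mu T x : R).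
Context (W : R -> {RV P >-> R}).
Context (BW : scaled_brownian_motion nu W) (nu0 : 0 < nu) (T0 : 0 < T).
Context (mu0 : 0 <= mu) (x0 : 0 < x).

Let th := 2 * mu / nu.

Let th0 : 0 <= th.
Proof. by rewrite divr_ge0 ?mulr_ge0// ltW. Qed.

Let mY (t : R) : measurable_fun setT (fun w => W t w - (mu * t + x)).
Proof. exact: measurable_funB. Qed.

Let Y (t : R) : {RV P >-> R} := mfun_Sub (mem_set (mY t)).

Let grid_last m : grid T m m.+1 = T.
Proof. by rewrite /grid mulrC divfK. Qed.

Let grid_ge0 m i : 0 <= grid T m i.
Proof. by rewrite mulr_ge0// divr_ge0// ltW. Qed.

Let grid_lt m j : (j <= m)%N -> grid T m j < T.
Proof.
move=> jm; rewrite -[ltRHS](grid_last m) /grid ltr_pM2r ?divr_gt0//.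
by rewrite ltr_nat ltnS.
Qed.

Let forgetsY m : forgets_past (fun i => Y (grid T m i)) m.+1.
Proof.
apply: (@forgets_past_shift _ _ _ _ _ (fun i => W (grid T m i)) (fun i =>
  mu * grid T m i + x)) => //.
apply: (scaled_markov BW); first exact: grid_ge0.
by move=> i j ij; rewrite /grid ler_wpM2r ?ler_nat// divr_ge0// ltW.
Qed.

Let Y_payoff (t v : R) : 0 <= t -> t < T ->
  (\int[P]_w (barrier_payoff th (v + (Y T w - Y t w)))%:E =
   (normal_tail (Num.sqrt (nu * (T - t))) (mu * (T - t) - v) +
    expR (th * v) *
      normal_tail (Num.sqrt (nu * (T - t))) (- (mu * (T - t)) - v))%:E)%E.
Proof.
move=> t0 tT; rewrite -[RHS](increment_payoff mu v BW nu0 t0 tT).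
by apply: eq_integral => w _; congr (barrier_payoff _ _)%:E; rewrite /=; ring.
Qed.

Let final_payoff (e : R) :
  (\int[P]_w (barrier_payoff th (Y T w - e))%:E = (passage_formula nu mu T (x +
    e))%:E)%E.
Proof.
have Y0 w : Y 0 w = - x by rewrite /= (scaled_start BW) mulr0 !add0r.
transitivity (\int[P]_w (barrier_payoff th (- (x + e) + (Y T w - Y 0 w)))%:E)%E.
  by apply: eq_integral => w _; congr (barrier_payoff _ _)%:E; rewrite Y0; ring.
rewrite [LHS](Y_payoff (- (x + e)) (lexx 0) T0) subr0 /passage_formula opprK
  mulrN mulNr.
by rewrite (addrC (- _) (x + e)).
Qed.

Let E_ m := [set w | exists2 j, (j <= m.+1)%N & 0 < Y (grid T m j) w].
Let E := [set w | exists2 t, 0 <= t <= T & mu * t + x < W t w].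

Let mE_ m : measurable (E_ m).
Proof.
rewrite /E_ -(@bigcup_first_passage _ _ _ _ (fun j => Y (grid T m j))).
apply: fin_bigcup_measurable; first exact: finite_finset.
by move=> j _; exact: sigma_past_measurable (@first_passage_in_past _ _ _ _ _
  j).
Qed.

Let Y_gt0 w t : (0 < Y t w) = (mu * t + x < W t w).
Proof. by rewrite /= subr_gt0. Qed.

Let E_E m : E_ m `<=` E.
Proof.
move=> w [j jm]; rewrite Y_gt0 => Wj; exists (grid T m j) => //.
rewrite grid_ge0/=; move: jm; rewrite leq_eqVlt => /predU1P[->|].
  by rewrite grid_last.
by rewrite ltnS => /grid_lt/ltW.
Qed.

Let Ycont w : {within `[0, +oo[, continuous (fun t => Y t w)}.
Proof.
have affine_cont : {within `[0, +oo[, continuous (fun t : R => mu * t + x)}.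
  apply: continuous_subspaceT => t; apply: cvgD; last exact: cvg_cst.
  by apply: cvgM; [exact: cvg_cst|exact: cvg_id].
by move=> t; apply: cvgB; [exact: (scaled_continuous BW)|exact: affine_cont].
Qed.

Let EE_ w : E w -> \forall m \near \oo, E_ m w.
Proof.
move=> [t tT]; rewrite -Y_gt0 => Yt.
by apply: (@grid_passage _ T (fun t => Y t w)) => //; exists t.
Qed.

Let mE : measurable E.
Proof.
have -> : E = [set w | exists2 t, 0 <= t <= T & 0 < Y t w].
  by apply/seteqP; split => w [t tT]; rewrite ?Y_gt0 => Wt; exists t;
    rewrite ?Y_gt0.
exact: measurable_passage.
Qed.

Let cvgE_ : (P (E_ m) @[m --> \oo] --> P E)%E.
Proof.
have P1 (A : set Omega) : measurable A -> (P A = \int[P]_(w in A) cst 1%E w)%E.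
  by move=> mA; rewrite integral_cst// mul1e.
rewrite P1//; under eq_fun do rewrite P1//.
apply: cvg_integral_sets => //.
- by apply: finite_measure_integrable_cst.
- move=> w; have [Ew|nEw] := pselect (E w).
    by have := EE_ Ew; apply: filterS => m Em; split.
  by apply: nearW => m; split => // /E_E.
Qed.

Lemma passage_le_formula : (P E <= (passage_formula nu mu T x)%:E)%E.
Proof.
apply: cvge_le cvgE_; apply: nearW => m.
have -> : (passage_formula nu mu T x)%:E =
    (\int[P]_w (barrier_payoff th (Y (grid T m m.+1) w))%:E)%E.
  rewrite grid_last -[x in LHS]addr0 -final_payoff.
  by apply: eq_integral => w _; rewrite subr0.
apply: (@passage_le_integral _ _ _ _ (fun i => Y (grid T m i))) => //.
- exact: measurable_barrier_payoff.
- exact: barrier_payoff_ge0.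
move=> j v; rewrite grid_last leq_eqVlt => /predU1P[->|jm] v0.
  rewrite grid_last; under eq_integral do rewrite subrr addr0.
  rewrite integral_cst// [X in (_ * X)%E]probability_setT mule1 lee_fin
    barrier_payoff_gt0//.
  by rewrite lerDl expR_ge0.
rewrite ltnS in jm.
rewrite Y_payoff ?grid_lt// lee_fin payoff_mean_ge1 ?(ltW v0)//.
by rewrite gt_eqF// sqrtr_gt0 mulr_gt0// subr_gt0 grid_lt.
Qed.

Let O_ e m := \bigcup_(j in [set: 'I_m.+2])
  (first_passage (fun i =>
    Y (grid T m i)) j `&` Y (grid T m j) @^-1` `]e, +oo[).

Let mO_ e m : measurable (O_ e m).
Proof.
apply: fin_bigcup_measurable; first exact: finite_finset.
move=> j _; apply: measurableI.
  exact: sigma_past_measurable (@first_passage_in_past _ _ _ _ _ j).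
by rewrite -[X in measurable X]setTI; exact: measurable_funPT.
Qed.

Let payoffT e w := (barrier_payoff th (Y T w - e))%:E.

Let payoffT_integrable e : P.-integrable setT (payoffT e).
Proof.
apply/integrableP; split.
  apply/measurable_EFinP;
    apply: (measurableT_comp (@measurable_barrier_payoff _ _)).
  exact: measurable_funB.
under eq_integral do rewrite gee0_abs ?lee_fin ?barrier_payoff_ge0//.
by rewrite [ltLHS]final_payoff ltry.
Qed.

Let cvgO_ e : 0 < e -> (\int[P]_(w in O_ e m) payoffT e w @[m --> \oo] --> 0)%E.
Proof.
move=> e0; rewrite -(integral_set0 P (payoffT e)).
apply: cvg_integral_sets => //.
- by move=> w; rewrite lee_fin barrier_payoff_ge0.
- move=> w; have Y00 : Y 0 w <= 0.
    by rewrite /= (scaled_start BW) mulr0 !add0r oppr_le0 ltW.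
  have := @grid_overshoot _ T e (fun t => Y t w) T0 e0 (@Ycont w) Y00.
  apply: filterS => m Ym; split => // -[j _ [[Yj0 Yi]]].
  rewrite /= in_itv/= andbT ltNge => /negP; apply.
  by apply: (Ym j) => //; rewrite -ltnS.
Qed.

Let formula_le_shift e : 0 < e ->
  ((passage_formula nu mu T (x + e))%:E <= P E)%E.
Proof.
move=> e0.
have lim : (P (E_ m) + \int[P]_(w in O_ e m) payoffT e w @[m --> \oo] --> P
  E)%E.
  rewrite -[X in _ --> X]adde0; apply: cvgeD; [|exact: cvgE_|exact: cvgO_].
  by rewrite fin_num_adde_defl.
apply: cvge_ge lim; apply: nearW => m.
rewrite -final_payoff.
have mh : measurable_fun setT (fun y : R => barrier_payoff th (y - e)).
  apply: (measurableT_comp (@measurable_barrier_payoff _ _)).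
  exact: measurable_funB.
have h0 (y : R) : 0 <= barrier_payoff th (y - e) by exact: barrier_payoff_ge0.
have hy (y : R) : y <= 0 -> barrier_payoff th (y - e) = 0.
  by move=> y0; apply: barrier_payoff_le0; rewrite subr_le0 (le_trans y0)// ltW.
have hle (j : nat) (v : R) : (j <= m.+1)%N -> v <= e ->
    (\int[P]_w (barrier_payoff th (v + (Y (grid T m m.+1) w - Y (grid T m j) w)
      - e)%R)%:E <= 1)%E.
  rewrite grid_last leq_eqVlt => /predU1P[->|jm] ve.
    rewrite grid_last; under eq_integral do rewrite subrr addr0.
    rewrite integral_cst// [X in (_ * X)%E]probability_setT mule1 lee_fin.
    by rewrite barrier_payoff_le0// subr_le0.
  rewrite ltnS in jm.
  under eq_integral do rewrite addrAC.
  rewrite [leLHS](Y_payoff (v - e) (grid_ge0 m j) (grid_lt jm)) lee_fin.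
  apply: payoff_mean_le1 => //; last by rewrite subr_le0.
  by rewrite gt_eqF// sqrtr_gt0 mulr_gt0// subr_gt0 grid_lt.
have hO (j : nat) w : (j <= m.+1)%N ->
  first_passage (fun i => Y (grid T m i)) j w ->
    e < Y (grid T m j) w -> O_ e m w.
  move=> jm fj ej; have jm' : (j < m.+2)%N by rewrite ltnS.
  by exists (Ordinal jm') => //; split => //=; rewrite in_itv/= andbT.
have := integral_le_passage (@forgetsY m) mh h0 hy hle (mO_ e m) hO.
by rewrite grid_last.
Qed.

(** The bound for the payoff shifted by [e] is moved back to [x] at a cost
    that vanishes with [e]: a factor [expR (th * e)] for the exponential
    weight, and the Lipschitz constant of each of the two tails. *)
Lemma formula_le_passage : ((passage_formula nu mu T x)%:E <= P E)%E.
Proof.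
set s := Num.sqrt (nu * T).
have s0 : s != 0 by rewrite gt_eqF// sqrtr_gt0 mulr_gt0.
have PE : P E \is a fin_num by rewrite fin_num_measure.
set p := fine (P E).
have pE : (p%:E = P E)%E by rewrite fineK.
rewrite -pE lee_fin.
have bound e : 0 < e ->
  passage_formula nu mu T x <= expR (th * e) * p + 2 * normal_peak s * e.
  move=> e0; have := formula_le_shift e0; rewrite -pE lee_fin => shift_le.
  have e1 : 1 <= expR (th * e) by rewrite -expR0 ler_expR mulr_ge0// ltW.
  have p0 := ler_wpM2l (expR_ge0 (th * e)) shift_le.
  rewrite -/th.
  apply: (@le_trans _ _ (expR (th * e) * passage_formula nu mu T (x + e) + 2 *
    normal_peak s * e)); last first.
    by rewrite lerD2r.
  rewrite /passage_formula -/s -/th.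
  have := @normal_tail_lipschitz _ s (mu * T + x) e s0 (ltW e0).
  have := @normal_tail_lipschitz _ s (x - mu * T) e s0 (ltW e0).
  rewrite -[mu * T + x + e]addrA [x - mu * T + e]addrAC.
  set A := normal_tail s (mu * T + (x + e));
    set B := normal_tail s (x + e - mu * T).
  move=> tB tA; rewrite mulrDr.
  have thx : expR (- th * x) <= 1 by rewrite -expR0 ler_expR mulNr oppr_le0
    mulr_ge0// ltW.
  have expE : expR (th * e) * (expR (- th * (x + e)) * B) = expR (- th * x) * B.
    by rewrite mulrA -expRD; congr (expR _ * _); ring.
  rewrite expE.
  have peak0 : 0 <= normal_peak s * e by rewrite mulr_ge0 ?normal_peak_ge0//
    ltW.
  have A_le : A <= expR (th * e) * A by rewrite ler_peMl ?normal_tail_ge0.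
  have := ler_wpM2l (expR_ge0 (- th * x)) tB.
  have : expR (- th * x) * (normal_peak s * e) <= normal_peak s * e by rewrite
    ler_piMl.
  rewrite mulrDr; lra.
(* the bound is continuous in e and equals p at 0 *)
have lim : expR (th * e) * p + 2 * normal_peak s * e @[e --> (0:R)^'+] --> p.
  rewrite -[X in _ --> X](_ : expR (th * 0) * p + 2 * normal_peak s * 0 = p);
    last first.
    by rewrite mulr0 expR0 mul1r mulr0 addr0.
  apply: cvg_at_right_filter; apply: cvgD; last by apply: cvgM;
    [exact: cvg_cst|exact: cvg_id].
  apply: cvgM; last exact: cvg_cst.
  apply: (cvg_comp _ expR); last exact: continuous_expR.
  by apply: cvgM; [exact: cvg_cst|exact: cvg_id].
apply: (cvgr_to_ge lim); near=> e; apply: bound; by near: e;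
  exact: nbhs_right_gt.
Unshelve. all: by end_near. Qed.

Lemma passage_probability : P E = (passage_formula nu mu T x)%:E.
Proof. by apply/le_anti; rewrite passage_le_formula formula_le_passage. Qed.

End passage.

(** * Sums of independent Brownian motions *)

Lemma sub_mutually_independent (R : realType) (d : measure_display)
    (Omega : measurableType d) (P : probability Omega R) (I : finType)
    (F G : I -> set (set Omega)) :
  (forall i, F i `<=` G i) -> mutually_independent P G ->
  mutually_independent P F.
Proof. by move=> FG indG A AF; apply: indG => i; exact: FG. Qed.

Lemma g_sigma_algebra_preimage_setT (T : pointedType) (d : measure_display)
    (T' : measurableType d) (X : T -> T') : g_sigma_algebra_preimage X setT.
Proof. by exists setT => //; rewrite preimage_setT setIT. Qed.

Lemma g_sigma_algebra_preimage_setI (T : pointedType) (d : measure_display)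
    (T' : measurableType d) (X : T -> T') :
  setI_closed (g_sigma_algebra_preimage X).
Proof.
move=> _ _ [A mA <-] [B mB <-]; exists (A `&` B); first exact: measurableI.
by rewrite !setTI preimage_setI.
Qed.

Lemma sub_g_sigma_algebra_preimage (T : pointedType) (d : measure_display)
    (T' : measurableType d) (X : T -> T') (G : set (set T)) :
  measurable_fun [set: g_sigma_algebraType G] X ->
  g_sigma_algebra_preimage X `<=` <<s G >>.
Proof. by move=> mX _ [B mB <-]; exact: mX. Qed.

Lemma measurable_sum_cond (R : realType) (d : measure_display)
    (T : measurableType d) (I : finType) (p : pred I) (f : I -> T -> R) :
  (forall i, p i -> measurable_fun setT (f i)) ->
  measurable_fun setT (fun x => \sum_(i | p i) f i x).
Proof.
move=> mf.
have -> : (fun x => \sum_(i | p i) f i x) = (fun x =>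
  \sum_i if p i then f i x else 0).
  by apply/funext => x; rewrite big_mkcond.
apply: measurable_sum => i; move: (mf i).
by case: (p i) => [/(_ isT)//|_]; exact: measurable_cst.
Qed.

Lemma within_continuous_sum (R : realType) (A : set R) (I : Type)
    (r : seq I) (f : I -> R -> R) :
  (forall k, {within A, continuous (f k)}) ->
  {within A, continuous (fun t => \sum_(k <- r) f k t)}.
Proof.
move=> cf; elim: r => [|k r IH].
  have -> : (fun t => \sum_(k <- [::]) f k t) = cst 0.
    by apply/funext => t; rewrite big_nil.
  by move=> t; exact: cvg_cst.
have -> : (fun t => \sum_(i <- k :: r) f i t) =
    (fun t => f k t + \sum_(i <- r) f i t).
  by apply/funext => t; rewrite big_cons.
by move=> t; apply: cvgD; [exact: cf|exact: IH].
Qed.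

Section sum_of_brownian_motions.
Context (R : realType) (d : measure_display) (Omega : measurableType d).
Context (P : probability Omega R) (N : nat) (B : 'I_N -> R -> {RV P >-> R}).
Context (indB : independent_standard_brownian_motions B).

Let mW (t : R) : measurable_fun setT (fun w =>
  \sum_(k < N) (B k t w - B k 0 w)).
Proof. by apply: measurable_sum => k; exact: measurable_funB. Qed.

(** Recentring at time 0 makes the process start at 0 everywhere, while each
    [B k] does so only almost surely. *)
Definition brownian_sum (t : R) : {RV P >-> R} := mfun_Sub (mem_set (mW t)).

Let process k := process_sigma_algebra (B k).

Let increment_process k (s t : R) : 0 <= s -> 0 <= t ->
  g_sigma_algebra_preimage (B k t \- B k s) `<=` process k.
Proof.
move=> s0 t0; apply: sub_g_sigma_algebra_preimage.
have mB r : 0 <= r -> measurable_fun [set: g_sigma_algebraType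
    (\bigcup_(t in `[0, +oo[) g_sigma_algebra_preimage (B k t))] (B k r).
  move=> r0 _ C mC; apply: sub_gen_smallest; exists r => /=;
    first by rewrite in_itv/= r0.
  by exists C.
by apply: measurable_funB; exact: mB.
Qed.

Let process_setT k : process k setT.
Proof. exact: (@measurableT _ (g_sigma_algebraType _)). Qed.

Let process_setI k : setI_closed (process k).
Proof. by move=> A C; exact: (@measurableI _ (g_sigma_algebraType _)). Qed.

Let sum_gaussian (s t : R) (m : nat) (mN : (m < N)%N) : 0 <= s -> s < t ->
  forall A, measurable A ->
  P ((fun w => \sum_(k < N | (k <= m)%N) (B k t w - B k s w)) @^-1` A) =
  normal_prob 0 (Num.sqrt (m.+1%:R * (t - s))) A.
Proof.
move=> s0 st.
have t0 : 0 <= t by rewrite (le_trans s0)// ltW.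
have h0 : 0 < t - s by rewrite subr_gt0.
pose D k := B k t \- B k s.
have mD k : measurable_fun setT (D k) by exact: measurable_funB.
have indD : mutually_independent P (fun k => g_sigma_algebra_preimage (D k)).
  by apply: sub_mutually_independent indB.2 => k; exact: increment_process.
have Dm_law k A : measurable A ->
  P (D k @^-1` A) = normal_prob 0 (Num.sqrt (t - s)) A.
  exact: (sbm_gaussian_increments (indB.1 k)).
elim: m mN => [|m IH] mN A mA.
  rewrite mul1r -(Dm_law (Ordinal mN))//; congr (P (_ @^-1` A));
    apply/funext => w.
  by rewrite (big_pred1 (Ordinal mN))// => k; rewrite leqn0.
have mS : measurable_fun setT (fun w => \sum_(k < N | (k <= m)%N) D k w).
  by apply: measurable_sum_cond => k _; exact: mD.
pose X : {RV P >-> R} := mfun_Sub (mem_set mS).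
pose Z : {RV P >-> R} := mfun_Sub (mem_set (mD (Ordinal mN))).
have -> : (fun w => \sum_(k < N | (k <= m.+1)%N) (B k t w - B k s w)) = X \+ Z.
  apply/funext => w /=; rewrite (bigD1 (Ordinal mN))//= addrC; congr (_ + _).
  apply: eq_bigl => k; rewrite -val_eqE/= leq_eqVlt.
  by have [->|/=] := eqVneq (k : nat) m.+1; rewrite ?ltnn//= andbT.
have sqr_m : Num.sqrt (m.+1%:R * (t - s)) ^+ 2 = m.+1%:R * (t - s).
  by rewrite sqr_sqrtr// mulr_ge0// ltW.
have indXZ A' C : measurable A' -> measurable C ->
    (P (X @^-1` A' `&` Z @^-1` C) = P (X @^-1` A') * P (Z @^-1` C))%E.
  move=> mA' mC.
  apply: (@mutually_independent_blocks _ _ _ P _ _ [pred k : 'I_N | (k <= m)%N]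
    _ _ _ _ _ indD).
  + by move=> k; exact: g_sigma_algebra_preimage_setI.
  + by move=> k; exact: g_sigma_algebra_preimage_setT.
  + by move=> k _ [C' mC' <-]; exact: (mD k measurableT C' mC').
  + set G := \bigcup_(_ in _) _.
    have mSG : measurable_fun [set: g_sigma_algebraType G]
        (fun w => \sum_(k < N | (k <= m)%N) D k w).
      apply: measurable_sum_cond => k km _ C' mC'; apply: sub_gen_smallest;
      exists k => //.
      by exists C'.
    by have := mSG measurableT A' mA'; rewrite setTI.
  + apply: sub_gen_smallest; exists (Ordinal mN);
      first by rewrite /= inE /= -ltnNge.
    by exists C => //; rewrite setTI.
have lawX A' : measurable A' ->
    P (X @^-1` A') = normal_prob 0 (Num.sqrt (m.+1%:R * (t - s))) A'.
  by move=> mA'; apply: IH => //; exact: ltnW.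
have lawZ A' : measurable A' ->
  P (Z @^-1` A') = normal_prob 0 (Num.sqrt (t - s)) A'.
  by move=> mA'; exact: Dm_law.
have sX : Num.sqrt (m.+1%:R * (t - s)) != 0 by rewrite gt_eqF// sqrtr_gt0
  mulr_gt0.
have sZ : Num.sqrt (t - s) != 0 by rewrite gt_eqF// sqrtr_gt0.
rewrite [LHS](normal_rvD sX sZ indXZ lawX lawZ mA).
congr (normal_prob 0 (Num.sqrt _) A).
by rewrite sqr_m sqr_sqrtr ?(ltW h0)// -[m.+2%:R]natr1 mulrDl mul1r.
Qed.

Let sum_markov (t : nat -> R) (n : nat) : 0 <= t 0%N ->
  nondecreasing_seq t -> forgets_past (brownian_sum \o t) n.
Proof.
move=> t0 ndt j jn A C pA mC.
(* the times 0, t 0, ..., t j, t n: the past increments followed by the future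
   one *)
pose u i := if i is i'.+1 then t (if (i' <= j)%N then i' else n) else 0.
have t_ge0 i : 0 <= t i by rewrite (le_trans t0)// ndt.
have u_ge0 i : 0 <= u i by case: i => [|i] //=.
have ndu : nondecreasing_seq u.
  move=> [|a] [|b] //= ab; apply: ndt.
  case: (leqP b j) => bj; first by rewrite (leq_trans _ bj).
  by case: ifP => // aj; rewrite (leq_trans aj).
pose inc (p : 'I_N * 'I_j.+2) : Omega -> R := B p.1 (u p.2.+1) \- B p.1 (u p.2).
have minc p : measurable_fun setT (inc p) by exact: measurable_funB.
have ind : mutually_independent P (fun p => g_sigma_algebra_preimage (inc p)).
  apply: (@mutually_independent_array _ _ _ P _ _ process
    (fun k (i : 'I_j.+2) =>
      g_sigma_algebra_preimage (B k (u i.+1) \- B k (u i)))) => //.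
  - by move=> k i; exact: increment_process.
  - exact: indB.2.
  - by move=> k; apply: (sbm_independent_increments (indB.1 k)) => //;
      exact: u_ge0.
(* the increments up to time t j, for all the processes *)
pose J : pred ('I_N * 'I_j.+2) := fun p => (p.2 <= j)%N.
have minc_in (K : pred ('I_N * 'I_j.+2)) p : K p ->
    measurable_fun [set: g_sigma_algebraType
      (\bigcup_(p in [set` K]) g_sigma_algebra_preimage (inc p))] (inc p).
  move=> Kp _ D mD; apply: sub_gen_smallest; exists p => //.
  by exists D.
apply: (@mutually_independent_blocks _ _ _ P _ _ J _ _ _ _ _ ind).
- by move=> p; exact: g_sigma_algebra_preimage_setI.
- by move=> p; exact: g_sigma_algebra_preimage_setT.
- by move=> p _ [D mD <-]; exact: (minc p measurableT D mD).
- move: A pA; apply: smallest_sub; first exact: smallest_sigma_algebra.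
  move=> D [i /= ij]; move: D; apply: sub_g_sigma_algebra_preimage.
  have WE w : \sum_(p : 'I_N * 'I_j.+2 | (p.2 <= i)%N) inc p w = brownian_sum
    (t i) w.
    rewrite -(pair_big_dep xpredT (fun _ (l : 'I_j.+2) => (l <= i)%N)
      (fun k l => inc (k, l) w))/=.
    apply: eq_bigr => k _.
    have iSS : (i.+1 <= j.+2)%N by rewrite ltnS (leq_trans ij).
    rewrite -(big_ord_widen j.+2 (fun l => B k (u l.+1) w - B k (u l) w) iSS).
    rewrite -(big_mkord xpredT (fun l => B k (u l.+1) w - B k (u l) w)).
    by rewrite telescope_sumr//= ij.
  rewrite [X in measurable_fun _ X](_ : _ =
      fun w => \sum_(p : 'I_N * 'I_j.+2 | (p.2 <= i)%N) inc p w); last first.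
    by apply/funext => w; rewrite WE.
  apply: measurable_sum_cond => p pi; apply: minc_in.
  exact: (leq_trans pi ij).
- have -> : (brownian_sum \o t) n \- (brownian_sum \o t) j =
      (fun w => \sum_(k < N) inc (k, ord_max) w).
    apply/funext => w /=; rewrite -sumrB; apply: eq_bigr => k _.
    by rewrite /inc/= leqnn ltnn opprB addrA subrK.
  set G := \bigcup_(_ in _) _.
  have mSG : measurable_fun [set: g_sigma_algebraType G]
      (fun w => \sum_(k < N) inc (k, ord_max) w).
    by apply: measurable_sum => k; apply: minc_in; rewrite /= /J /= -ltnNge.
  by have := mSG measurableT C mC; rewrite setTI.
Qed.

Let sum_continuous w : {within `[0, +oo[, continuous (fun t =>
  brownian_sum t w)}.
Proof.
pose increment k t := B k t w - B k 0 w.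
have cinc k : {within `[0, +oo[, continuous (increment k)}.
  by move=> t; apply: cvgB; [exact: (sbm_continuous (indB.1 k))|exact: cvg_cst].
exact: within_continuous_sum.
Qed.

Lemma scaled_brownian_sum :
    (0 < N)%N -> scaled_brownian_motion N%:R brownian_sum.
Proof.
move=> N0; split => //.
- by move=> w /=; apply: big1 => k _; rewrite subrr.
- move=> s t s0 st A mA.
  have NE : N.-1.+1 = N by rewrite prednK.
  have N1 : (N.-1 < N)%N by rewrite NE.
  have := sum_gaussian N1 s0 st mA; rewrite NE => <-.
  congr (P (_ @^-1` A)); apply/funext => w /=; rewrite -sumrB.
  rewrite [RHS](eq_bigl xpredT); last by move=> k; rewrite -ltnS NE ltn_ord.
  by apply: eq_bigr => k _; rewrite opprB addrA subrK.
Qed.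

End sum_of_brownian_motions.

(** * The exceedance events *)

(** Both events have to be measurable, as a measure is unconstrained
    elsewhere. *)
Lemma measure_ae_eq (R : realType) (d : measure_display)
    (T : measurableType d) (mu : {measure set T -> \bar R}) (A B : set T) :
  measurable A -> measurable B -> {ae mu, forall x, A x <-> B x} -> mu A = mu B.
Proof.
move=> mA mB AB; rewrite -[A]setIT -[B]setIT -!(integral_indic mu
  measurableT)//.
apply: ae_eq_integral => //.
- exact/measurable_EFinP/measurable_indic.
- exact/measurable_EFinP/measurable_indic.
move: AB; apply: filterS => x iffAB _; rewrite !indicE; congr (_%:R%:E).
by congr nat_of_bool; apply/idP/idP; rewrite !inE => /iffAB.
Qed.

Lemma exceedanceE (R : realType) (d : measure_display)
    (Omega : measurableType d)
    (P : probability Omega R) (N : nat) (B : 'I_N -> R -> {RV P >-> R})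
    (T a c : R) :
  exceedance B T a c = [set w | exists2 t, 0 <= t <= T &
    c * N%:R * t + a * N%:R < \sum_(k < N) B k t w].
Proof.
apply/seteqP; split => w /=.
  move=> /ereal_sup_gt[y [t tT <-]]; rewrite lte_fin => Bt.
  by exists t; [move: tT; rewrite /= in_itv|rewrite addrC -ltrBrDr].
move=> [t tT Bt]; apply/ereal_sup_gtP.
exists ((\sum_(k < N) B k t w - c * N%:R * t)%:E);
  last by rewrite lte_fin ltrBrDr addrC.
by exists t => //=; rewrite in_itv.
Qed.

(** The sum of the [B k] and its recentred version differ only on a null
    set, and both exceedance events are measurable by continuity of the
    paths. *)
Lemma exceedance_probability (R : realType) (d : measure_display)
    (Omega : measurableType d) (P : probability Omega R) (N : nat)
    (B : 'I_N -> R -> {RV P >-> R}) (T a c : R) :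
  independent_standard_brownian_motions B -> (0 < N)%N ->
  0 < T -> 0 < a -> 0 < c ->
  P (exceedance B T a c) = (passage_formula N%:R (c * N%:R) T (a * N%:R))%:E.
Proof.
move=> indB N0 T0 a0 c0.
have N0' : 0 < N%:R :> R by rewrite ltr0n.
have cN : 0 <= c * N%:R by rewrite mulr_ge0// ltW.
rewrite -(passage_probability (scaled_brownian_sum indB N0) N0' T0 cN (mulr_gt0
  a0 N0')).
have shift (X : R -> Omega -> R) :
    [set w | exists2 t, 0 <= t <= T & c * N%:R * t + a * N%:R < X t w] =
    [set w | exists2 t, 0 <= t <= T & 0 < X t w - (c * N%:R * t + a * N%:R)].
  by apply/seteqP; split => w [t tT Xt]; exists t => //;
    rewrite ?subr_gt0// -subr_gt0.
have caff : {within `[0, +oo[, continuous (fun t : R =>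
  c * N%:R * t + a * N%:R)}.
  apply: continuous_subspaceT => t; apply: cvgD; last exact: cvg_cst.
  by apply: cvgM; [exact: cvg_cst|exact: cvg_id].
have BW := scaled_brownian_sum indB N0.
apply: measure_ae_eq.
- rewrite exceedanceE shift; apply: measurable_passage => // [t|w].
    by apply: measurable_funB => //; apply: measurable_sum.
  have csum : {within `[0, +oo[, continuous (fun t => \sum_(k < N) B k t w)}.
    by apply: within_continuous_sum => k; exact: (sbm_continuous (indB.1 k)).
  by move=> t; apply: cvgB; [exact: csum|exact: caff].
- rewrite shift; apply: measurable_passage => // [t|w].
    exact: measurable_funB.
  by move=> t; apply: cvgB; [exact: (scaled_continuous BW)|exact: caff].
have B0 : {ae P, forall w, forall k, B k 0 w = 0}.
  by apply: filter_forall => k; exact: (sbm_start (indB.1 k)).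
move: B0; apply: filterS => w B0; rewrite exceedanceE /=.
have sumE t : brownian_sum B t w = \sum_(k < N) B k t w.
  by rewrite /=; apply: eq_bigr => k _; rewrite B0 subr0.
split => -[t tT Bt]; exists t => //; first by rewrite [ltRHS]sumE.
by rewrite -[ltRHS]sumE.
Qed.

(** * Asymptotics *)

(** The Mills bound at level [b * N] for the variance [N * T], written as it
    appears in the theorem. *)
Lemma normal_pdf_scaled (R : realType) (T b : R) (N : nat) : 0 < T -> 0 < b ->
  let s := Num.sqrt (N.+1%:R * T) in
  s ^+ 2 / (b * N.+1%:R) * normal_pdf 0 s (b * N.+1%:R) =
  (Num.sqrt (2 * pi))^-1 * (Num.sqrt T / b) * (Num.sqrt N.+1%:R)^-1 *
  expR (- (b ^+ 2 / (2 * T)) * N.+1%:R).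
Proof.
move=> T0 b0 s.
have N0 : 0 < N.+1%:R :> R by rewrite ltr0n.
have s0 : s != 0 by rewrite gt_eqF// sqrtr_gt0 mulr_gt0.
have s2 : s ^+ 2 = N.+1%:R * T by rewrite sqr_sqrtr// ltW// mulr_gt0.
have -> : normal_pdf 0 s (b * N.+1%:R) =
    (Num.sqrt (2 * pi))^-1 * (Num.sqrt T)^-1 * (Num.sqrt N.+1%:R)^-1 *
    expR (- (b ^+ 2 / (2 * T)) * N.+1%:R).
  rewrite normal_pdfE//; congr (_ * expR _); last first.
    by rewrite s2 -mulr_natl subr0; field; rewrite !gt_eqF.
  rewrite /normal_peak s2 -!invfM; congr (_^-1).
  rewrite -!sqrtrM ?mulr_ge0 ?pi_ge0 ?(ltW T0)//; congr (Num.sqrt _).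
  by rewrite -mulr_natl; ring.
rewrite s2 [in N.+1%:R * T](_ : T = Num.sqrt T ^+ 2);
  last by rewrite sqr_sqrtr// ltW.
rewrite !mulrA; congr (_ * _); congr (_ * _).
field; rewrite !gt_eqF ?sqrtr_gt0 ?mulr_gt0 ?pi_gt0//.
Qed.

Lemma normal_tail_mills_scaled (R : realType) (T b : R) (N : nat) :
  0 < T -> 0 < b ->
  let p := (Num.sqrt (2 * pi))^-1 * (Num.sqrt T / b) * (Num.sqrt N.+1%:R)^-1 *
    expR (- (b ^+ 2 / (2 * T)) * N.+1%:R) in
  let q := normal_tail (Num.sqrt (N.+1%:R * T)) (b * N.+1%:R) in
  q <= p /\ p <= (1 + T / b ^+ 2 / N.+1%:R) * q.
Proof.
move=> T0 b0 p q.
have N0 : 0 < N.+1%:R :> R by rewrite ltr0n.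
have s0 : 0 < Num.sqrt (N.+1%:R * T) by rewrite sqrtr_gt0 mulr_gt0.
have := normal_tail_mills s0 (mulr_gt0 b0 N0).
rewrite normal_pdf_scaled// -/p -/q sqr_sqrtr ?mulr_ge0 ?(ltW T0)//.
rewrite (_ : N.+1%:R * T / (b * N.+1%:R) ^+ 2 = T / b ^+ 2 / N.+1%:R);
  last first.
  by field; rewrite !gt_eqF.
by move=> /andP[].
Qed.

Lemma cvg_invn (R : realType) : (n%:R^-1 : R) @[n --> \oo] --> (0 : R).
Proof.
apply/gtr0_cvgV0; last exact: cvgr_idn.
by exists 1%N => // n /= n1; rewrite ltr0n.
Qed.

Lemma cvg_inv_sqrtn (R : realType) :
    ((Num.sqrt n%:R)^-1 : R) @[n --> \oo] --> (0 : R).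
Proof.
under eq_fun do rewrite -sqrtrV//.
rewrite -(@sqrtr0 R); apply: (cvg_comp _ Num.sqrt (@cvg_invn R)).
exact: sqrt_continuous.
Qed.

(** Leading term of [scaled_tail]. *)
Definition tail_rate (R : realType) (T b : R) (N : nat) : R :=
  (Num.sqrt (2 * pi))^-1 * (Num.sqrt T / b) * (Num.sqrt N%:R)^-1 *
    expR (- (b ^+ 2 / (2 * T)) * N%:R).

Definition scaled_tail (R : realType) (T b : R) (N : nat) : R :=
  normal_tail (Num.sqrt (N%:R * T)) (b * N%:R).

Lemma scaled_tail_asymp (R : realType) (T b : R) : 0 < T -> 0 < b ->
  asymp_equal (scaled_tail T b) (tail_rate T b).
Proof.
move=> T0 b0.
have Tb0 : 0 <= T / b ^+ 2 by rewrite divr_ge0 ?sqr_ge0// ltW.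
have lim : (1 + T / b ^+ 2 * N%:R^-1)^-1 @[N --> \oo] --> (1 : R).
  rewrite -[X in _ --> X]invr1; apply: cvgV; first exact: oner_neq0.
  rewrite -[X in _ --> X]addr0; apply: cvgD; first exact: cvg_cst.
  rewrite -(mulr0 (T / b ^+ 2)); apply: cvgM; [exact: cvg_cst|exact: cvg_invn].
apply: (squeeze_cvgr _ lim); last exact: (@cvg_cst R^o).
exists 1%N => // -[//|N _] /=.
have [qp pq] := normal_tail_mills_scaled N T0 b0.
have p0 : 0 < tail_rate T b N.+1.
  by rewrite mulr_gt0 ?expR_gt0// mulr_gt0 ?invr_gt0 ?sqrtr_gt0 ?ltr0n//
    mulr_gt0 ?divr_gt0 ?invr_gt0 ?sqrtr_gt0// mulr_gt0// pi_gt0.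
have k0 : 0 < 1 + T / b ^+ 2 * N.+1%:R^-1 :> R.
  by rewrite ltr_pwDl// mulr_ge0.
by rewrite ler_pdivlMr// ler_pdivrMr// mul1r qp andbT mulrC ler_pdivrMr// mulrC.
Qed.

(** The exponential rates at most cancel, and the factor 1 / sqrt N of the
    Mills bound remains. *)
Lemma scaled_tail_expR_cvg0 (R : realType) (T b g : R) :
  0 < T -> 0 < b -> g <= b ^+ 2 / (2 * T) ->
  scaled_tail T b N * expR (g * N%:R) @[N --> \oo] --> (0 : R).
Proof.
move=> T0 b0 gb.
pose C := (Num.sqrt (2 * pi))^-1 * (Num.sqrt T / b).
have C0 : 0 <= C.
  by rewrite mulr_ge0 ?divr_ge0 ?invr_ge0 ?sqrtr_ge0// ltW.
have lim : C * (Num.sqrt N%:R)^-1 @[N --> \oo] --> (0 : R).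
  by rewrite -(mulr0 C); apply: cvgM; [exact: cvg_cst|exact: cvg_inv_sqrtn].
apply: (squeeze_cvgr _ _ lim); last exact: (@cvg_cst R^o).
exists 1%N => // -[//|N _] /=.
rewrite mulr_ge0 ?normal_tail_ge0 ?expR_ge0//=.
have [qp _] := normal_tail_mills_scaled N T0 b0.
apply: (le_trans (ler_wpM2r (expR_ge0 _) qp)).
rewrite -/C -[leLHS]mulrA -expRD ler_piMr ?(mulr_ge0 C0) ?invr_ge0 ?sqrtr_ge0//.
by rewrite -[leRHS]expR0 ler_expR -mulrDl mulr_le0_ge0// addrC subr_le0.
Qed.

Lemma passage_formula_scaled (R : realType) (a c T : R) (N : nat) :
  passage_formula N.+1%:R (c * N.+1%:R) T (a * N.+1%:R) =
  scaled_tail T (a + c * T) N.+1 +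
  expR (- (2 * a * c * N.+1%:R)) * scaled_tail T (a - c * T) N.+1.
Proof.
have N0 : N.+1%:R != 0 :> R by rewrite pnatr_eq0.
rewrite /passage_formula /scaled_tail;
  congr (normal_tail _ _ + expR _ * normal_tail _ _).
- by ring.
- by field.
- by ring.
Qed.

(** The second exceedance entails the first: [T <= (a2 - a1) / (c1 - c2)]
    says that the second line is the higher one on the whole of [0, T]. *)
Lemma psi_passage (R : realType) (d : measure_display)
    (Omega : measurableType d)
    (P : probability Omega R) (N : nat) (B : 'I_N.+1 -> R -> {RV P >-> R})
    (T a1 c1 a2 c2 : R) :
  0 < T -> 0 < c2 -> c2 < c1 -> 0 < a1 -> a1 < a2 ->
  independent_standard_brownian_motions B -> T <= (a2 - a1) / (c1 - c2) ->
  psi B T a1 c1 a2 c2 =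
  scaled_tail T (a2 + c2 * T) N.+1 +
  expR (- (2 * a2 * c2 * N.+1%:R)) * scaled_tail T (a2 - c2 * T) N.+1.
Proof.
move=> T0 c20 c21 a10 a12 indB Tstar.
rewrite -passage_formula_scaled /psi setIidr.
  by rewrite exceedance_probability// (lt_trans a10).
rewrite !exceedanceE => w [t /andP[t0 tT] Bt]; exists t; first by rewrite t0 tT.
apply: le_lt_trans Bt; rewrite -!mulrA (mulrC _ t) !mulrA -!mulrDl ler_wpM2r//.
move: Tstar; rewrite ler_pdivlMr ?subr_gt0// => Tstar.
have c120 : 0 <= c1 - c2 by rewrite subr_ge0 ltW.
have := ler_wpM2r c120 tT; lra.
Qed.

Lemma asymp_equal_shift (R : realType) (f f' g : nat -> R) :
  (forall N, f N.+1 = f' N.+1) -> asymp_equal f' g -> asymp_equal f g.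
Proof.
move=> ff' f'g; apply: cvg_trans f'g; apply: near_eq_cvg.
by exists 1%N => // -[//|N _] /=; rewrite ff'.
Qed.

Lemma asymp_equal_linear (R : realType) (f1 f2 g : nat -> R) (x y : R) :
  0 < x -> 0 < y -> asymp_equal f1 (fun N => x * g N) ->
  asymp_equal f2 (fun N => y * g N) ->
  asymp_equal (fun N => f1 N + f2 N) (fun N => (x + y) * g N).
Proof.
move=> x0 y0 lim1 lim2; rewrite /asymp_equal.
have xy0 : 0 < x + y by rewrite addr_gt0.
have -> : (fun N => (f1 N + f2 N) / ((x + y) * g N)) =
    (fun N => x / (x + y) * (f1 N / (x * g N)) + y / (x + y) * (f2 N / (y * g
      N))).
  apply/funext => N; rewrite !invfM; move: (g N)^-1 => G; field.
  by rewrite !gt_eqF.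
rewrite -[X in _ --> X](_ : x / (x + y) * 1 + y / (x + y) * 1 = 1); last first.
  by rewrite !mulr1 -mulrDl divff// gt_eqF.
by apply: cvgD; apply: cvgM => //; exact: cvg_cst.
Qed.

Lemma scaled_tail_opp (R : realType) (T b : R) (N : nat) : 0 < T ->
  scaled_tail T (- b) N.+1 = 1 - scaled_tail T b N.+1.
Proof.
move=> T0; rewrite /scaled_tail mulNr normal_tail_opp// gt_eqF// sqrtr_gt0.
by rewrite mulr_gt0// ltr0n.
Qed.

Theorem theorem2p4 (R : realType) (T a1 c1 a2 c2 : R)
    (d : nat -> measure_display) (Omega : forall N : nat, measurableType (d N))
    (P : forall N : nat, probability (Omega N) R)
    (B : forall N : nat, 'I_N -> R -> {RV (P N) >-> R}) :
  0 < T -> 0 < c2 -> c2 < c1 -> 0 < a1 -> a1 < a2 ->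
  (forall N : nat, independent_standard_brownian_motions (B N)) ->
  let tstar := (a2 - a1) / (c1 - c2) in
  let t2 := a2 / c2 in
  let psi_T := fun N : nat => psi (B N) T a1 c1 a2 c2 in
  T <= tstar ->
  [/\ T < t2 ->
        asymp_equal psi_T (fun N : nat =>
          (Num.sqrt (2 * pi))^-1 *
          (Num.sqrt T / (a2 + c2 * T) + Num.sqrt T / (a2 - c2 * T)) *
          (Num.sqrt N%:R)^-1 *
          expR (- ((a2 + c2 * T) ^+ 2 / (2 * T)) * N%:R)),
      t2 = T ->
        asymp_equal psi_T (fun N : nat =>
          2^-1 * expR (- (2 * a2 * c2 * N%:R)))
    & t2 < T ->
        asymp_equal psi_T (fun N : nat => expR (- (2 * a2 * c2 * N%:R)))].

Proof.
move=> T0 c20 c21 a10 a12 indB tstar t2 psi_T Ttstar.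
have a20 : 0 < a2 by rewrite (lt_trans a10).
set bp := a2 + c2 * T; set bm := a2 - c2 * T.
have bp0 : 0 < bp by rewrite addr_gt0// mulr_gt0.
have psiE N : psi_T N.+1 = scaled_tail T bp N.+1 +
    expR (- (2 * a2 * c2 * N.+1%:R)) * scaled_tail T bm N.+1.
  exact: psi_passage (indB N.+1) Ttstar.
have rateE : bp ^+ 2 / (2 * T) = 2 * a2 * c2 + bm ^+ 2 / (2 * T).
  by rewrite /bp /bm; field; rewrite gt_eqF.
(* the first tail relative to exp(- 2 a2 c2 N): negligible when t2 <= T *)
pose main N := scaled_tail T bp N * expR (2 * a2 * c2 * N%:R).
have main0 : main N @[N --> \oo] --> (0 : R).
  apply: scaled_tail_expR_cvg0 => //.
  by rewrite rateE lerDl divr_ge0 ?sqr_ge0// mulr_ge0// ltW.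
have ratioE (k : R) N : k != 0 ->
    psi_T N.+1 / (k * expR (- (2 * a2 * c2 * N.+1%:R))) =
    k^-1 * (main N.+1 + scaled_tail T bm N.+1).
  move=> k0; rewrite psiE /main expRN.
  have e0 : expR (2 * a2 * c2 * N.+1%:R) != 0 by rewrite gt_eqF// expR_gt0.
  by field; rewrite k0 e0.
have asymp_ratio (k : R) : k != 0 -> 
    (scaled_tail T bm N @[N --> \oo] --> k) ->
    asymp_equal psi_T (fun N => k * expR (- (2 * a2 * c2 * N%:R))).
  move=> k0 limk.
  have lim : k^-1 * (main N + scaled_tail T bm N) @[N --> \oo] --> (1 : R).
    rewrite -[X in _ --> X](mulVf k0) -[X in k^-1 * X]add0r.
    apply: cvgM; first exact: cvg_cst.
    exact: cvgD.
  apply: cvg_trans lim; apply: near_eq_cvg.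
  by exists 1%N => // -[//|N _] /=; rewrite ratioE.
split.
- rewrite /t2 ltr_pdivlMr// => T_t2.
  have bm0 : 0 < bm by rewrite subr_gt0 mulrC.
  (* both terms have the rate g, as bp^2 / 2T = 2 a2 c2 + bm^2 / 2T *)
  pose g N : R := (Num.sqrt (2 * pi))^-1 * (Num.sqrt N%:R)^-1 * expR (- (bp ^+
    2 / (2 * T)) * N%:R).
  have rate1 : tail_rate T bp = (fun N => Num.sqrt T / bp * g N).
    by apply/funext => N; rewrite /tail_rate /g; ring.
  have rate2 N : expR (- (2 * a2 * c2 * N%:R)) * tail_rate T bm N = Num.sqrt T
    / bm * g N.
    rewrite /tail_rate /g rateE mulrCA.
    rewrite (_ : - (2 * a2 * c2 + bm ^+ 2 / (2 * T)) * N%:R =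
      - (2 * a2 * c2 * N%:R) + - (bm ^+ 2 / (2 * T)) * N%:R); last by ring.
    by rewrite expRD; ring.
  have -> : (fun N => (Num.sqrt (2 * pi))^-1 * (Num.sqrt T / bp + Num.sqrt T /
    bm) *
      (Num.sqrt N%:R)^-1 * expR (- (bp ^+ 2 / (2 * T)) * N%:R)) =
      (fun N => (Num.sqrt T / bp + Num.sqrt T / bm) * g N).
    by apply/funext => N; rewrite /g; ring.
  apply: (@asymp_equal_shift _ _ (fun N => scaled_tail T bp N +
    expR (- (2 * a2 * c2 * N%:R)) * scaled_tail T bm N)) => //.
  apply: asymp_equal_linear; rewrite ?divr_gt0 ?sqrtr_gt0//.
    by rewrite -rate1; exact: scaled_tail_asymp.
  rewrite /asymp_equal.
  have -> : (fun N => expR (- (2 * a2 * c2 * N%:R)) * scaled_tail T bm N /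
      (Num.sqrt T / bm * g N)) = (fun N =>
      scaled_tail T bm N / tail_rate T bm N).
    apply/funext => N; rewrite -rate2 invfM mulrACA divff ?mul1r//.
    by rewrite gt_eqF// expR_gt0.
  exact: scaled_tail_asymp.
- move=> t2T; have bm0 : bm = - 0.
    by apply/eqP; rewrite oppr0 subr_eq0 -t2T /t2 mulrC divfK// gt_eqF.
  apply: asymp_ratio => //.
  apply: cvg_near_cst; exists 1%N => // -[//|N _] /=.
  have := @scaled_tail_opp R T 0 N T0; rewrite bm0 oppr0 => half; lra.
- rewrite /t2 ltr_pdivrMr// => t2_T.
  have bm0 : 0 < - bm by rewrite oppr_gt0 subr_lt0 mulrC.
  have lim : scaled_tail T (- bm) N * expR (0 * N%:R) @[N --> \oo] --> (0 : R).
    apply: scaled_tail_expR_cvg0 => //.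
    by rewrite divr_ge0 ?sqr_ge0// mulr_ge0// ltW.
  have : asymp_equal psi_T (fun N => 1 * expR (- (2 * a2 * c2 * N%:R))).
    apply: asymp_ratio; first exact: oner_neq0.
    have lim1 : 1 - scaled_tail T (- bm) N * expR (0 * N%:R) @[N --> \oo] -->
      (1 : R).
      rewrite -[X in _ --> X]subr0; apply: cvgB => //; exact: cvg_cst.
    apply: cvg_trans lim1; apply: near_eq_cvg; exists 1%N => // -[//|N _] /=.
    by rewrite mul0r expR0 mulr1 -scaled_tail_opp// opprK.
  by rewrite /asymp_equal; under eq_fun do rewrite mul1r.
Qed.
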